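(* Let $\ell\in\mathbb{N}_0$ and let $\mu\geq2\ell+1$ be an odd integer. Then for all $j,k\in\mathbb{N}_0$ $$\int_0^\infty M_j^{\mu,\ell}(x)M_k^{\mu,\ell}(x)\,x^{\mu-2\ell}e^{-x}\,dx=\begin{cases}\dfrac{2\Gamma(j+\mu+1)\Gamma(j+\ell+\frac{\mu+3}{2})\Gamma(j-\ell+\frac{\mu+1}{2})}{j!\,(2j+\mu+1)\,\Gamma(j+\frac{\mu+1}{2})^2} & (j=k),\\[2mm] 0 & (j\neq k),\end{cases}$$ and the sequence $(M_j^{\mu,\ell})_{j\in\mathbb{N}_0}$ is complete in $L^2(\mathbb{R}_+,x^{\mu-2\ell}e^{-x}\,dx)$.
   Context: Let $I_\alpha$, $K_\alpha$ be the modified Bessel functions and set $\widetilde I_\alpha(z)=(z/2)^{-\alpha}I_\alpha(z)$, $\widetilde K_\alpha(z)=(z/2)^{-\alpha}K_\alpha(z)$. For $\mu\in\mathbb{C}$, $\ell\in\mathbb{N}_0$, $x>0$ and $t$ near $0$ define $$G^{\mu,\ell}(t,x)=\frac{1}{(1-t)^{\ell+\frac{\mu+3}{2}}}\left(\frac x2\right)^{2\ell+1}e^{\frac x2}\,\widetilde I_{\frac\mu2}\!\left(\frac{tx}{2(1-t)}\right)\widetilde K_{\ell+\frac12}\!\left(\frac{x}{2(1-t)}\right),$$ and $M_j^{\mu,\ell}(x)=\frac{\Gamma(j+\mu+1)}{j!\,2^\mu\,\Gamma(j+\frac{\mu+1}{2})}\left.\frac{\partial^j}{\partial t^j}\right|_{t=0}G^{\mu,\ell}(t,x)$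 for $j\in\mathbb{N}_0$ (a polynomial in $x$). *)

(* Defs.v *)
From HB Require Import structures.
From mathcomp Require Import all_boot all_order all_algebra.
From mathcomp Require Import all_classical all_reals all_analysis.
Set Implicit Arguments. Unset Strict Implicit. Unset Printing Implicit Defensive.
Import Order.TTheory GRing.Theory Num.Theory.
Import numFieldNormedType.Exports.
Local Open Scope classical_set_scope.
Local Open Scope ring_scope.

Section BesselDefs.
Variable R : realType.
Local Notation leb := (@lebesgue_measure R).

Definition Gamma (s : R) : R :=
  fine (\int[leb]_(t in `]0%R, +oo[) ((t `^ (s - 1)) * expR (- t))%:E).

Definition coshR (t : R) : R := (expR t + expR (- t)) / 2.

(* tilde I_a(z) = (z/2)^(-a) I_a(z) = sum_m (z/2)^(2m) / (m! Gamma(m+a+1)),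
   the entire function given by the power series. *)
Definition Itilde (a z : R) : R :=
  limn (fun n : nat => \sum_(0 <= m < n)
          ((z / 2) ^+ (2 * m) / (m`!%:R * Gamma (m%:R + a + 1)))).

Definition BesselK (a z : R) : R :=
  fine (\int[leb]_(t in `[0%R, +oo[) (expR (- (z * coshR t)) * coshR (a * t))%:E).

Definition Ktilde (a z : R) : R := (z / 2) `^ (- a) * BesselK a z.

Definition Gfun (mu : R) (l : nat) (t x : R) : R :=
  (1 - t) `^ (- (l%:R + (mu + 3) / 2)) * (x / 2) ^+ (2 * l + 1) * expR (x / 2)
  * Itilde (mu / 2) (t * x / (2 * (1 - t)))
  * Ktilde (l%:R + 1 / 2) (x / (2 * (1 - t))).

Definition Mpol (mu : R) (l j : nat) (x : R) : R :=
  Gamma (j%:R + mu + 1) / (j`!%:R * 2 `^ mu * Gamma (j%:R + (mu + 1) / 2))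
  * derive1n j (fun t => Gfun mu l t x) 0.

(* Weight x^(mu - 2l) e^(-x) on R_+ (mu, l naturals with 2l <= mu). *)
Definition weight (mu l : nat) (x : R) : R := x ^+ (mu - 2 * l) * expR (- x).

Definition complete_in_L2 (w : R -> R) (phi : nat -> R -> R) : Prop :=
  forall f : R -> R,
    measurable_fun (`]0%R, +oo[ : set R) f ->
    (\int[leb]_(x in `]0%R, +oo[) ((f x) ^+ 2 * w x)%:E < +oo)%E ->
    forall eps : R, 0 < eps ->
      exists (n : nat) (c : nat -> R),
        (\int[leb]_(x in `]0%R, +oo[)
            ((f x - \sum_(j < n) c j * phi j x) ^+ 2 * w x)%:E < eps%:E)%E.

End BesselDefs.

(* Main.v *)
(** The closed form of K_{l+1/2} and Kummer's second formula show that, on x > 0, M_j is a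
    multiple kappa_j of the polynomial N_j with generating function
      sum_j N_j(x) t^j = (1-t)^{-(b-l)-1} D(x/(1-t)) Phi(tx/(1-t)),    mu = 2b+1,
    where D is the (reversed) Bessel polynomial of degree l and Phi(z) = 1F1(b+1; 2b+2; -z).
    It yields a three-term ladder relation for the operator T = 2(theta + b+1-l) - x,
    theta = x d/dx, and an eigenvalue equation of order four for N_j. The latter gives
    <N_0, N_j> = 0 for j > 0; as T is skew-adjoint for x^(mu-2l) e^-x dx, the ladder spreads
    this to full orthogonality and relates successive norms, and <N_0, N_0> comes from a
    recursion on the moments of D^2.
    Polynomials are dense in L^2(x^n e^-x dx): Taylor expansion puts all x^m e^(-kx/8) in their
    closure, hence the functions exp(-k e^(-k(x-d))), which tend to the indicator of x > d, hence
    all indicators and all square-integrable functions. Applying this to f/x^(2l) with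
    n = mu+2l, it remains to see that every x^(2l) q lies in the span of the N_j. Reducing by
    degree leaves a remainder r of degree < l. The eigenvalue equation kills the odd Taylor
    coefficients of order < 2l of e^(-x/2) N_j, hence those of e^(-x/2) r, which forces r = 0. *)
Require Import Defs.
From HB Require Import structures.
From mathcomp Require Import all_boot all_order all_algebra.
From mathcomp Require Import all_classical all_reals all_analysis.
From mathcomp Require Import measurable_realfun ring lra zify.
Set Implicit Arguments. Unset Strict Implicit. Unset Printing Implicit Defensive.
Import Order.TTheory GRing.Theory Num.Theory.
Import numFieldNormedType.Exports.
Local Open Scope classical_set_scope.
Local Open Scope ring_scope.

(** * Coefficients of the generating function *)

Section Euler.
Variable R : comNzRingType.

(** Up to the Gram matrix everything is algebra over a field. Integrals against e^(-x) become the
    linear functional [lapl], which sends x^i to i!. Facts about the generating function become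
    relations between the coefficient families [phi C p q j]: differentiation in x or t and the
    second-order equations of D and Phi shift the indices C, p, q, j, so a claimed identity can be
    brought to a normal form that [ring] decides. With mu = 2b+1 the condition mu >= 2l+1 reads l <=
    b, and the weight is x^(2(b-l)+1) e^(-x). Completeness does not follow from density of
    polynomials alone. Since N_j has degree l+j, the span of the N_j has codimension l among
    polynomials; it is cut out by the l conditions that the odd Taylor coefficients of e^(-x/2) p of
    order below 2l vanish. Every multiple of x^(2l) meets them, which is why f is divided by x^(2l)
    before it is approximated. *)

Lemma natr_mul_poly n (p : {poly R}) : n%:R * p = n%:R *: p.
Proof. by rewrite -mul_polyC polyC_natr. Qed.

Definition euler (p : {poly R}) : {poly R} := 'X * p^`().

Lemma eulerD p q : euler (p + q) = euler p + euler q.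
Proof. by rewrite /euler derivD mulrDr. Qed.
Lemma eulerN p : euler (- p) = - euler p.
Proof. by rewrite /euler derivN mulrN. Qed.
Lemma eulerB p q : euler (p - q) = euler p - euler q.
Proof. by rewrite eulerD eulerN. Qed.
Lemma eulerM p q : euler (p * q) = euler p * q + p * euler q.
Proof. rewrite /euler derivM; ring. Qed.
Lemma eulerX : euler 'X = 'X.
Proof. by rewrite /euler derivX mulr1. Qed.
Lemma eulerZ c p : euler (c *: p) = c *: euler p.
Proof. by rewrite /euler derivZ scalerAr. Qed.
Lemma euler_nat n : euler n%:R = 0.
Proof. by rewrite /euler -polyC_natr derivC mulr0. Qed.
Lemma eulerXn n : euler 'X^n = n%:R * 'X^n.
Proof. by case: n => [|n]; rewrite /euler derivXn ?mulr0 ?mul0r//= -mulr_natl exprS; ring. Qed.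
Lemma euler_sum I (r : seq I) (P : pred I) F :
  euler (\sum_(i <- r | P i) F i) = \sum_(i <- r | P i) euler (F i).
Proof. apply: (big_morph euler eulerD); by rewrite /euler deriv0 mulr0. Qed.
Lemma coef_euler p n : (euler p)`_n = n%:R * p`_n.
Proof.
by case: n => [|n]; rewrite /euler coefXM ?mul0r//= coef_deriv mulr_natl.
Qed.
End Euler.

(** * Coefficient families of the generating function and their relations *)

Section GeneratingCoefficients.
Variables (R : numFieldType) (l b : nat).
Local Notation a := b.+1.

(** Normalised so that K_{l+1/2}(z) = sqrt(pi/(2z)) e^(-z) y^(-l) D(y) with y = 2z and D = sum_i
    [bessel_coef i] y^i. *)
Definition bessel_coef i : R := (2 * l - i)`!%:R / (i`!%:R * (l - i)`!%:R).

(** The Taylor coefficients (-1)^k (b+1)_k / ((2b+2)_k k!) of Phi, generated by their ratio. *)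
Fixpoint kummer_coef k : R :=
  if k is k'.+1 then - (a + k')%:R / (k%:R * (2 * a + k')%:R) * kummer_coef k' else 1.

Arguments kummer_coef : simpl never.

(** Coefficient form of the equation theta^2 D = (2l+1) theta D + y (theta - l) D. *)
Lemma bessel_coefS i : (i < l)%N ->
  i.+1%:R * (2 * l - i)%:R * bessel_coef i.+1 = (l - i)%:R * bessel_coef i :> R.
Proof.
move=> il; rewrite /bessel_coef.
have -> : (2 * l - i = (2 * l - i.+1).+1)%N by lia.
have -> : (l - i = (l - i.+1).+1)%N by lia.
rewrite !factS !natrM.
have h n : n`!%:R != 0 :> R by rewrite pnatr_eq0 -lt0n fact_gt0.
have h' n : n.+1%:R != 0 :> R by rewrite pnatr_eq0.
by field; rewrite !h !nat1r !h'.
Qed.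

(** Coefficient form of the equation theta (theta + 2b+1) Phi = - z (theta + b+1) Phi. *)
Lemma kummer_coefS k : k.+1%:R * (2 * a + k)%:R * kummer_coef k.+1 = - (a + k)%:R * kummer_coef k.
Proof.
rewrite /kummer_coef -/kummer_coef.
have h' n : n.+1%:R != 0 :> R by rewrite pnatr_eq0.
have -> : (2 * a + k = (2 * b + k.+1).+1)%N by lia.
field; rewrite nat1r h' andbT.
have -> : 1 + (2 * b%:R + k.+1%:R) = (2 * b + k).+2%:R :> R by rewrite -!natr1 natrD natrM; ring.
exact: h'.
Qed.

(* Coefficient of t^j in (1-t)^{-C-1} (theta^p D)(x/(1-t)) (theta^q f)(tx/(1-t)),
   where D = sum bessel_coef_i y^i and f = sum kummer_coef_k z^k. *)
Definition phi C p q j : {poly R} :=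
  \sum_(i < l.+1) \sum_(k < j.+1)
    (i%:R ^+ p * bessel_coef i * (k%:R ^+ q * kummer_coef k) * 'C(C + i + j, j - k)%:R) *:
      'X^(i + k).

(** Raising C by one divides the generating function by 1-t. *)
Lemma phi_pascal C p q j : phi C.+1 p q j.+1 = phi C p q j.+1 + phi C.+1 p q j.
Proof.
rewrite /phi -big_split; apply: eq_bigr => i _ /=.
rewrite big_ord_recr [X in _ = X + _]big_ord_recr /= addrAC -big_split /=; congr (_ + _).
  apply: eq_bigr => k _; rewrite -scalerDl -mulrDr; congr (_ * _ *: _).
  have kj : (k <= j)%N by rewrite -ltnS.
  rewrite -natrD; congr (_%:R); rewrite subSn//.
  by rewrite addSn addSn addnS binS addnC addnC.
by rewrite subnn !bin0.
Qed.

Lemma phi_pascal0 C p q : phi C.+1 p q 0 = phi C p q 0.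
Proof.
rewrite /phi; apply: eq_bigr => i _; apply: eq_bigr => k _.
by rewrite ord1 !bin0.
Qed.

(** Both arguments x/(1-t) and tx/(1-t) are linear in x, so theta acts on either factor by the
    product rule. *)
Lemma euler_phi C p q j : euler (phi C p q j) = phi C p.+1 q j + phi C p q.+1 j.
Proof.
rewrite /phi euler_sum -big_split; apply: eq_bigr => i _ /=.
rewrite euler_sum -big_split; apply: eq_bigr => k _ /=.
rewrite eulerZ eulerXn -scalerDl natr_mul_poly scalerA; congr (_ *: _).
rewrite natrD !exprS; ring.
Qed.

(** This is t d/dt. The argument x/(1-t) has logarithmic derivative 1/(1-t) in t, while tx/(1-t) has
    1/(t(1-t)); hence the last term keeps the index j+1. *)
Lemma phi_index C p q j :
  j.+1%:R * phi C p q j.+1 =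
  C.+1%:R * phi C.+1 p q j + phi C.+1 p.+1 q j + phi C.+1 p q.+1 j.+1.
Proof.
rewrite /phi !mulr_sumr -!big_split; apply: eq_bigr => i _ /=.
rewrite big_ord_recr mulrDr [X in _ = _ + X]big_ord_recr /= addrA; congr (_ + _); last first.
  rewrite subnn !bin0 natr_mul_poly scalerA; congr (_ *: _); rewrite exprS; ring.
rewrite !mulr_sumr -!big_split; apply: eq_bigr => k _ /=.
have kj : (k <= j)%N by rewrite -ltnS.
rewrite !(natr_mul_poly _ (_ *: _)) !scalerA -!scalerDl; congr (_ *: _).
have E : ((j.+1 - k) * 'C(C + i + j.+1, j.+1 - k) =
          (C + i + k).+1 * 'C(C.+1 + i + j, j - k))%N.
  rewrite subSn// (_ : C + i + j.+1 = (C + i + j).+1)%N; last by lia.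
  rewrite mul_bin_left (_ : C.+1 + i + j = (C+i+j).+1)%N; last by lia.
  by congr (_ * _)%N; lia.
have E' : ('C(C.+1 + i + j.+1, j.+1 - k) =
  'C(C + i + j.+1, j.+1 - k) + 'C(C.+1 + i + j, j - k))%N.
  by rewrite subSn// !addSn !addnS binS addnC addnC.
rewrite E' natrD.
move/(congr1 (fun n => n%:R : R)): E; rewrite !natrM natrB ?(leqW kj)//.
rewrite -!natr1 !natrD => E.
set B1 := 'C(C + i + j.+1, j.+1 - k)%:R in E *.
set B2 := 'C(C.+1 + i + j, j - k)%:R in E *.
have -> : (j%:R + 1) * (i%:R ^+ p * bessel_coef i * (k%:R ^+ q * kummer_coef k) * B1) =
 (i%:R ^+ p * bessel_coef i * (k%:R ^+ q * kummer_coef k)) * ((j%:R + 1 - k%:R) * B1)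
  + k%:R * (i%:R ^+ p * bessel_coef i * (k%:R ^+ q * kummer_coef k)) * B1 by ring.
by rewrite E !exprS; ring.
Qed.

(** The equation of D at y = x/(1-t); the factor y contributes x and raises C. *)
Lemma phi_bessel C q j : phi C 2 q j =
  (2 * l + 1)%:R * phi C 1 q j + 'X * (phi C.+1 1 q j - l%:R * phi C.+1 0 q j).
Proof.
apply/eqP; rewrite addrC -subr_eq; apply/eqP.
rewrite /phi !mulr_sumr -!sumrB mulr_sumr big_ord_recl [RHS]big_ord_recr.
rewrite addrC; congr (_ + _); last first.
  transitivity (0 : {poly R}); [|symmetry].
    rewrite mulr_sumr -sumrB big1// => k _.
    by rewrite !expr0n /= !(mul0r, mulr0, scale0r) subrr.
  rewrite mulr_sumr -sumrB big1 ?mulr0// => k _.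
  rewrite natr_mul_poly !scalerA -scalerBl.
  by rewrite [X in X *: _](_ : _ = 0) ?scale0r//; ring.
apply: eq_bigr => i _; rewrite lift0 !mulr_sumr -!sumrB mulr_sumr.
apply: eq_bigr => k _ /=.
rewrite !(natr_mul_poly _ (_ *: _)) !scalerA -!scalerBl -(scalerAr _ 'X) -exprS addSn;
  congr (_ *: _).
rewrite (_ : C + i.+1 + j = C.+1 + i + j)%N; last by lia.
set B := 'C(_, _)%:R.
have il : (i < l)%N by [].
have E := bessel_coefS il.
transitivity (- ((k%:R ^+ q * kummer_coef k) * B) * (i.+1%:R * (2 * l - i)%:R * bessel_coef i.+1)).
  rewrite natrB ?natrD ?natrM; last by lia.
  ring.
rewrite E natrB ?(ltnW il)//; ring.
Qed.

(** The equation of Phi at z = tx/(1-t); the factor z contributes x, raises C and lowers the index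
    of t. *)
Lemma phi_kummer C p j : phi C p 2 j.+1 =
  - (2 * b + 1)%:R * phi C p 1 j.+1
  - 'X * (phi C.+1 p 1 j + b.+1%:R * phi C.+1 p 0 j).
Proof.
apply/eqP; rewrite addrC mulNr -subr_eq opprK; apply/eqP.
rewrite /phi !mulr_sumr -!big_split mulr_sumr -sumrN; apply: eq_bigr => i _ /=.
rewrite !mulr_sumr -!big_split mulr_sumr -sumrN big_ord_recl.
rewrite [X in _ X _ = _](_ : _ = 0) ?[LHS]add0r; last first.
  by rewrite /= !expr0n /= !(mul0r, mulr0, scale0r) addr0.
apply: eq_bigr => k _; rewrite lift0 /=.
rewrite !(natr_mul_poly _ (_ *: _)) !scalerA -!scalerDl -(scalerAr _ 'X) -exprS (addnS i k)
  -scaleNr; congr (_ *: _).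
rewrite (_ : C + i + j.+1 = C.+1 + i + j)%N ?subSS; last by lia.
set B := 'C(_, _)%:R.
transitivity ((i%:R ^+ p * bessel_coef i * B) * (k.+1%:R * (2 * a + k)%:R * kummer_coef k.+1)).
  ring.
rewrite kummer_coefS !natrD; ring.
Qed.

End GeneratingCoefficients.

(** * Ladder relation and eigenvalue equation *)

Section Ladder.
Variables (R : numFieldType) (l b : nat).
Local Notation phi := (phi R l b).

(* [phi] with its last index shifted by 6 and extended by 0, so that the relations below
   hold without boundary cases. *)
Definition sphi C p q n : {poly R} := if (n < 6)%N then 0 else phi C p q (n - 6).

Lemma sphi_pascal C p q n : sphi C p q n.+1 = sphi C.+1 p q n.+1 - sphi C.+1 p q n.
Proof.
rewrite /sphi; case: (ltngtP n 5) => [n5|n5|->].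
- by rewrite !ifT ?subr0//; lia.
- rewrite !ifN; try lia.
  by rewrite subSn; [rewrite phi_pascal addrK|lia].
- by rewrite /= subnn phi_pascal0 subr0.
Qed.

Lemma euler_sphi C p q n : euler (sphi C p q n) = sphi C p.+1 q n + sphi C p q.+1 n.
Proof.
rewrite /sphi; case: ifP => _; last exact: euler_phi.
by rewrite /euler deriv0 mulr0 addr0.
Qed.

(** The factor n - 5 is the unshifted index of the left side. At n = 5 the right side vanishes too:
    index 5 stands for -1, and theta kills the constant term of Phi. *)
Lemma sphi_index C p q n :
  (n%:R - 5) * sphi C p q n.+1 =
  C.+1%:R * sphi C.+1 p q n + sphi C.+1 p.+1 q n + sphi C.+1 p q.+1 n.+1.
Proof.
rewrite /sphi; case: (ltngtP n 5) => [n5|n5|->].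
- by rewrite !ifT ?mulr0 ?addr0//; lia.
- rewrite !ifN; try lia.
  rewrite subSn; last lia.
  rewrite -phi_index; congr (_ * _).
  by rewrite -natrB; [congr (_%:R); lia|lia].
- rewrite /= subnn mulr0 !add0r subrr mul0r.
  rewrite [RHS]big1// => i _; rewrite big1// => k _.
  by rewrite ord1 exprS mul0r mul0r mulr0 mul0r scale0r.
Qed.

Lemma sphi_bessel C q n : sphi C 2 q n =
  (2 * l%:R + 1) * sphi C 1 q n + 'X * (sphi C.+1 1 q n - l%:R * sphi C.+1 0 q n).
Proof.
rewrite /sphi; case: ifP => _; first by rewrite !mulr0 subrr mulr0 addr0.
by rewrite phi_bessel natrD natrM.
Qed.

Lemma sphi_kummer C p n : sphi C p 2 n.+1 =
  - (2 * b%:R + 1) * sphi C p 1 n.+1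
  - 'X * (sphi C.+1 p 1 n + (b%:R + 1) * sphi C.+1 p 0 n).
Proof.
rewrite /sphi; case: (ltngtP n 5) => [n5|n5|->].
- by rewrite !ifT ?mulr0 ?addr0 ?mulr0 ?subr0//; lia.
- rewrite !ifN; try lia.
  rewrite subSn; last lia.
  by rewrite phi_kummer -natr1 natrD natrM.
- rewrite /= subnn !mulr0 addr0 mulr0 subr0.
  rewrite [LHS]big1; last first.
    move=> i _; rewrite big1// => k _.
    by rewrite ord1 exprS mul0r mul0r mulr0 mul0r scale0r.
  rewrite [X in _ * X]big1 ?mulr0//.
  move=> i _; rewrite big1// => k _.
  by rewrite ord1 exprS mul0r mul0r mulr0 mul0r scale0r.
Qed.

(* The operator annihilating x^(l+1/2) e^(x/2) K_{l+1/2}(x/2), conjugated by x^m. *)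
Definition qop (m : nat) (p : {poly R}) : {poly R} :=
  let E p := euler p + m%:R * p in
  E (E p) - (2 * l%:R + 1) * E p - 'X * (E p - l%:R * p).

Hypothesis lb : (l <= b)%N.
Local Notation N n := (sphi (b - l) 0 0 n).

(** A normal form decides it: the index relations absorb the factors j, the two differential
    equations bring p and q down to at most 1, and Pascal's relation lifts all terms to a common
    C. *)
Lemma sphi_ladder j :
  2 * (j%:R + b%:R + 1) * (euler (N j.+2.+4) + (b%:R + 1 - l%:R) * N j.+2.+4)
  - (j%:R + b%:R + 1) * ('X * N j.+2.+4)
  = (j%:R + 1) * (j%:R + 2 * (b%:R + 1)) * N j.+3.+4
   - (j%:R + b%:R + 1 + l%:R) * (j%:R + b%:R - l%:R) * N j.+1.+4.
Proof.
rewrite euler_sphi.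
set c := (b - l)%N.
have bE : b%:R = c%:R + l%:R :> {poly R} by rewrite /c natrB// subrK.
have ix0 C p q : (j%:R + 1) * sphi C p q j.+3.+4 = (C%:R + 1) * sphi C.+1 p q j.+2.+4 +
  sphi C.+1 p.+1 q j.+2.+4 + sphi C.+1 p q.+1 j.+3.+4.
  by rewrite [C%:R + 1]natr1 -sphi_index; congr (_ * _); ring.
have ix1 C p q : j%:R * sphi C p q j.+2.+4 = (C%:R + 1) * sphi C.+1 p q j.+1.+4 +
  sphi C.+1 p.+1 q j.+1.+4 + sphi C.+1 p q.+1 j.+2.+4.
  by rewrite [C%:R + 1]natr1 -sphi_index; congr (_ * _); ring.
have ix2 C p q : (j%:R - 1) * sphi C p q j.+1.+4 = (C%:R + 1) * sphi C.+1 p q j.+4 +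
  sphi C.+1 p.+1 q j.+4 + sphi C.+1 p q.+1 j.+1.+4.
  by rewrite [C%:R + 1]natr1 -sphi_index; congr (_ * _); ring.
have ix3 C p q : (j%:R - 2) * sphi C p q j.+4 = (C%:R + 1) * sphi C.+1 p q j.+3 +
  sphi C.+1 p.+1 q j.+3 + sphi C.+1 p q.+1 j.+4.
  by rewrite [C%:R + 1]natr1 -sphi_index; congr (_ * _); ring.
(* The products are regrouped so that every factor depending on j meets a term whose index relation
   absorbs it; hence the shifts j - 1 and j - 2. *)
have -> : (j%:R + 1) * (j%:R + 2 * (b%:R + 1)) * N j.+3.+4 =
   (c%:R + 1) * (j%:R * sphi c.+1 0 0 j.+2.+4) + j%:R * sphi c.+1 1 0 j.+2.+4
   + (j%:R + 1) * sphi c.+1 0 1 j.+3.+4 - sphi c.+1 0 1 j.+3.+4 +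
   2 * (b%:R + 1) * ((c%:R + 1) * sphi c.+1 0 0 j.+2.+4 + sphi c.+1 1 0 j.+2.+4 +
     sphi c.+1 0 1 j.+3.+4).
  transitivity (j%:R * ((j%:R + 1) * N j.+3.+4) + 2 * (b%:R + 1) * ((j%:R + 1) * N j.+3.+4)).
    ring.
  by rewrite ix0; ring.
have -> : (j%:R + b%:R + 1 + l%:R) * (j%:R + b%:R - l%:R) * N j.+1.+4 =
   (c%:R + 1) * ((j%:R - 2) * sphi c.+1 0 0 j.+4 + sphi c.+1 0 0 j.+4)
     + (j%:R - 2) * sphi c.+1 1 0 j.+4 + sphi c.+1 1 0 j.+4
   + (j%:R - 1) * sphi c.+1 0 1 j.+1.+4 +
   (2 * b%:R + 3) * ((c%:R + 1) * sphi c.+1 0 0 j.+4 + sphi c.+1 1 0 j.+4 + sphi c.+1 0 1 j.+1.+4)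
   + (b%:R + 2 + l%:R) * (b%:R + 1 - l%:R) * N j.+1.+4.
  transitivity ((j%:R - 1) * ((j%:R - 1) * N j.+1.+4) + (2 * b%:R + 3) * ((j%:R - 1) * N j.+1.+4)
   + (b%:R + 2 + l%:R) * (b%:R + 1 - l%:R) * N j.+1.+4); first by ring.
  rewrite ix2; ring.
have -> : 2 * (j%:R + b%:R + 1) *
  (sphi c 1 0 j.+2.+4 + sphi c 0 1 j.+2.+4 + (b%:R + 1 - l%:R) * N j.+2.+4)
  - (j%:R + b%:R + 1) * ('X * N j.+2.+4) =
  2 * (j%:R * sphi c 1 0 j.+2.+4 + j%:R * sphi c 0 1 j.+2.+4 + (b%:R + 1 - l%:R) *
    (j%:R * N j.+2.+4))
  - 'X * (j%:R * N j.+2.+4) + (b%:R + 1) *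
   (2 * (sphi c 1 0 j.+2.+4 + sphi c 0 1 j.+2.+4 + (b%:R + 1 - l%:R) * N j.+2.+4) - 'X * N j.+2.+4).
  ring.
rewrite !ix0 !ix1 !ix2 !ix3 !sphi_bessel !sphi_kummer.
rewrite !(sphi_pascal c) !(sphi_pascal c.+1) !(sphi_pascal c.+2).
rewrite -/c bE.
rewrite -![c.+1%:R]natr1.
ring.
Qed.

Let eulerE := (eulerD, eulerN, eulerM, eulerX, @euler_nat R, @euler_nat R 1, euler_sphi).

(** Both differential equations remove the second powers of theta here, before the second operator
    is applied, so that the fourth-order identity starts from a short expression. *)
Lemma qop_sphi j : qop 0 (N j.+2.+4) =
  2 * sphi (b - l) 1 1 j.+2.+4 - 2 * (b%:R + 1 + l%:R) * sphi (b - l) 0 1 j.+2.+4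
  + 'X * (sphi (b - l).+1 1 0 j.+1.+4 - sphi (b - l).+1 0 1 j.+2.+4
          - (b%:R + 1 + l%:R) * sphi (b - l).+1 0 0 j.+1.+4).
Proof.
rewrite /qop mulr0n !mul0r !addr0 euler_sphi eulerD !euler_sphi !sphi_bessel !sphi_kummer.
rewrite !(sphi_pascal (b - l)); ring.
Qed.

Lemma sphi_eigen j : qop (2 * b + 1) (qop 0 (N j.+2.+4)) =
  j%:R * (j%:R + 2 * (b%:R + 1)) * ('X ^+ 2 * N j.+2.+4).
Proof.
set c := (b - l)%N.
have bE : b%:R = c%:R + l%:R :> {poly R} by rewrite /c natrB// subrK.
have ix1 C p q : j%:R * sphi C p q j.+2.+4 = (C%:R + 1) * sphi C.+1 p q j.+1.+4 +
  sphi C.+1 p.+1 q j.+1.+4 + sphi C.+1 p q.+1 j.+2.+4.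
  by rewrite [C%:R + 1]natr1 -sphi_index; congr (_ * _); ring.
have ix2 C p q : (j%:R - 1) * sphi C p q j.+1.+4 = (C%:R + 1) * sphi C.+1 p q j.+4 +
  sphi C.+1 p.+1 q j.+4 + sphi C.+1 p q.+1 j.+1.+4.
  by rewrite [C%:R + 1]natr1 -sphi_index; congr (_ * _); ring.
transitivity ('X ^+ 2 * ((c%:R + 1) * ((j%:R - 1) * sphi c.+1 0 0 j.+1.+4 + sphi c.+1 0 0 j.+1.+4) +
  ((j%:R - 1) * sphi c.+1 1 0 j.+1.+4 + sphi c.+1 1 0 j.+1.+4) + j%:R * sphi c.+1 0 1 j.+2.+4 +
  2 * (b%:R + 1) * (j%:R * sphi c 0 0 j.+2.+4))); last first.
  transitivity ('X ^+ 2 * ((j%:R + 2 * (b%:R + 1)) * (j%:R * N j.+2.+4))); last by ring.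
  rewrite (ix1 c); ring.
rewrite !ix1 !ix2 qop_sphi -/c /qop natrD natrM.
set h := (X in euler (euler X + _ * X)).
have hE : euler h = 2 * (sphi c 2 1 j.+2.+4 + sphi c 1 2 j.+2.+4)
  - 2 * (b%:R + 1 + l%:R) * (sphi c 1 1 j.+2.+4 + sphi c 0 2 j.+2.+4)
  + 'X * (sphi c.+1 1 0 j.+1.+4 - sphi c.+1 0 1 j.+2.+4
          - (b%:R + 1 + l%:R) * sphi c.+1 0 0 j.+1.+4)
  + 'X * (sphi c.+1 2 0 j.+1.+4 + sphi c.+1 1 1 j.+1.+4 - sphi c.+1 1 1 j.+2.+4
     - sphi c.+1 0 2 j.+2.+4
          - (b%:R + 1 + l%:R) * (sphi c.+1 1 0 j.+1.+4 + sphi c.+1 0 1 j.+1.+4)).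
  rewrite /h !eulerE; ring.
rewrite !sphi_bessel !sphi_kummer in hE.
rewrite hE /h !eulerE !sphi_bessel !sphi_kummer.
rewrite !(sphi_pascal c) !(sphi_pascal c.+1) !(sphi_pascal c.+2) bE -![c.+1%:R]natr1.
ring.
Qed.
End Ladder.

(** * The polynomials N_j *)

Section Npol.
Variables (R : numFieldType) (l b : nat).
Hypothesis lb : (l <= b)%N.
Definition Npol j : {poly R} := phi R l b (b - l) 0 0 j.
Local Notation D := (Npol 0).
Local Notation Q := (@qop R l).

Lemma NpolE j : Npol j = sphi R l b (b - l) 0 0 j.+2.+4.
Proof. by rewrite /sphi /= !subSS subn0. Qed.

Lemma Npol_ladder0 : 2 * (b%:R + 1) * (euler D + (b%:R + 1 - l%:R) * D)
  - (b%:R + 1) * ('X * D) = 2 * (b%:R + 1) * Npol 1.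
Proof.
have := sphi_ladder R lb 0; rewrite -!NpolE !mulr0n !add0r => ->.
by rewrite /sphi /= mulr0 subr0 mul1r.
Qed.

Lemma Npol_ladder j : 2 * (j.+1%:R + b%:R + 1) * (euler (Npol j.+1) + (b%:R + 1 - l%:R) * Npol j.+1)
  - (j.+1%:R + b%:R + 1) * ('X * Npol j.+1)
  = j.+2%:R * (j.+1%:R + 2 * (b%:R + 1)) * Npol j.+2
   - (j.+1%:R + b%:R + 1 + l%:R) * (j.+1%:R + b%:R - l%:R) * Npol j.
Proof. by have := sphi_ladder R lb j.+1; rewrite -!NpolE => ->; rewrite natr1. Qed.

Lemma Npol_eigen j : Q (2 * b + 1) (Q 0 (Npol j)) =
  j%:R * (j%:R + 2 * (b%:R + 1)) * ('X ^+ 2 * Npol j).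
Proof. by rewrite NpolE sphi_eigen. Qed.

Lemma Npol0E : D = \sum_(i < l.+1) bessel_coef R l i *: 'X^i.
Proof.
rewrite /Npol /phi; apply: eq_bigr => i _; rewrite big_ord1 addn0 bin0 /=
  !mulr1 expr0 mul1r addn0 //.
Qed.

(** At j = 0 each term of [qop_sphi] has index -1 or carries theta Phi, whose constant term is 0. *)
Lemma Q_Npol0 : Q 0 D = 0.
Proof.
rewrite NpolE qop_sphi// /sphi /=.
have z C p : phi R l b C p 1 0 = 0.
  rewrite [LHS]big1// => i _; rewrite big1// => k _.
  by rewrite ord1 mul0r mulr0 mul0r scale0r.
by rewrite !z !(mulr0, subr0, addr0).
Qed.

Lemma coef_phi C p q j n : (phi R l b C p q j)`_n =
  \sum_(i < l.+1) \sum_(k < j.+1 | (i + k == n)%N)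
    i%:R ^+ p * bessel_coef R l i * (k%:R ^+ q * kummer_coef R b k) * 'C(C + i + j, j - k)%:R.
Proof.
rewrite coef_sum; apply: eq_bigr => i _; rewrite coef_sum [RHS]big_mkcond.
apply: eq_bigr => k _; rewrite coefZ coefXn eq_sym.
by case: eqP; rewrite ?mulr1 ?mulr0.
Qed.

Lemma kummer_coef_neq0 k : kummer_coef R b k != 0.
Proof.
elim: k => [|k IH]; first exact: oner_neq0.
rewrite /kummer_coef -/(kummer_coef R b) mulf_neq0// mulf_neq0 ?oppr_eq0 ?invr_eq0 ?mulf_neq0
  ?pnatr_eq0//.
Qed.

Lemma bessel_coef_neq0 i : bessel_coef R l i != 0.
Proof. by rewrite /bessel_coef !mulf_neq0 ?invr_eq0 ?mulf_neq0// pnatr_eq0 -lt0n fact_gt0. Qed.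

(** Only i = l and k = j reach degree l+j, with a nonzero coefficient. No N_j has degree below l,
    which is the gap that completeness must close. *)
Lemma size_Npol j : size (Npol j) = (l + j).+1.
Proof.
apply/eqP; rewrite eqn_leq; apply/andP; split.
  apply/leq_sizeP => n jn; rewrite coef_phi big1// => i _; rewrite big1// => k.
  have := ltn_ord i; have := ltn_ord k; lia.
rewrite ltnNge; apply/negP => /leq_sizeP/(_ _ (leqnn _)).
rewrite coef_phi big_ord_recr /= big1 ?add0r; last first.
  move=> i _; rewrite big1// => k; have := ltn_ord i; have := ltn_ord k.
  rewrite /=; lia.
rewrite (big_pred1 ord_max) => [|k]; last by rewrite eqn_add2l.
move/eqP; apply/negP; rewrite subnn bin0 mulr1 mulf_neq0 ?kummer_coef_neq0 ?bessel_coef_neq0//.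
  by rewrite expr0 mul1r bessel_coef_neq0.
by rewrite expr0 mul1r kummer_coef_neq0.
Qed.

End Npol.

(** * Gram matrix *)

Section LaplaceFunctional.
Variable R : numFieldType.

(* The integral of p(x) e^(-x) over x > 0, see [integral_horner_expRN]. *)
Definition lapl (p : {poly R}) : R := \sum_(i < size p) p`_i * i`!%:R.

Lemma lapl_wide n (p : {poly R}) : (size p <= n)%N ->
  lapl p = \sum_(i < n) p`_i * i`!%:R.
Proof.
move=> pn; rewrite /lapl (big_ord_widen _ (fun i => p`_i * i`!%:R) pn).
rewrite [LHS]big_mkcond; apply: eq_bigr => i _; case: ltnP => // h.
by rewrite nth_default ?mul0r.
Qed.

Lemma laplD p q : lapl (p + q) = lapl p + lapl q.
Proof.
have h1 := leq_maxl (size p) (size q); have h2 := leq_maxr (size p) (size q).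
rewrite (lapl_wide h1) (lapl_wide h2) (lapl_wide (size_polyD p q)) -big_split.
by apply: eq_bigr => i _; rewrite coefD mulrDl.
Qed.

Lemma laplZ c p : lapl (c *: p) = c * lapl p.
Proof.
rewrite (lapl_wide (size_scale_leq c p)) /lapl mulr_sumr.
by apply: eq_bigr => i _; rewrite coefZ mulrA.
Qed.

Lemma laplN p : lapl (- p) = - lapl p.
Proof. by rewrite -scaleN1r laplZ mulN1r. Qed.

Lemma laplB p q : lapl (p - q) = lapl p - lapl q.
Proof. by rewrite laplD laplN. Qed.

Lemma lapl_nat n p : lapl (n%:R * p) = n%:R * lapl p.
Proof. by rewrite natr_mul_poly laplZ. Qed.

(** Integration by parts against e^(-x), with its boundary term at 0. *)
Lemma lapl_deriv p : lapl p^`() = lapl p - p`_0.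
Proof.
rewrite (@lapl_wide (size p)); last by rewrite (leq_trans (size_poly _ _)) ?leq_pred.
rewrite (lapl_wide (leqnSn _)) big_ord_recl fact0 mulr1 addrC addKr.
apply: eq_bigr => i _; rewrite lift0 coef_deriv factS natrM mulrA -mulr_natr; ring.
Qed.

(** The argument is the derivative of x^(s+1) p e^(-x) stripped of e^(-x); the factor x^(s+1) kills
    the boundary term. *)
Lemma lapl_euler s p : lapl ('X^s * ((s%:R + 1) * p + euler p - 'X * p)) = 0.
Proof.
have -> : 'X^s * ((s%:R + 1) * p + euler p - 'X * p) = ('X^(s.+1) * p)^`() - 'X^(s.+1) * p.
  by rewrite derivM derivXn /= -[_ *+ s.+1]mulr_natl -natr1 /euler !exprS; ring.
by rewrite laplB lapl_deriv coefXnM /= subr0 subrr.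
Qed.

End LaplaceFunctional.

Section BesselOperatorCoef.
Variables (R : numFieldType) (l : nat).

Lemma coef_qop0 (p : {poly R}) n : (qop l 0 p)`_n =
  n%:R * (n%:R - 2 * l%:R - 1) * p`_n - (if n is k.+1 then (k%:R - l%:R) * p`_k else 0).
Proof.
rewrite /qop mulr0n !mul0r !addr0 !coefB !coef_euler coefXM.
have -> : (2 * l%:R + 1 : {poly R}) = (2 * l%:R + 1)%:P.
  by rewrite polyCD polyCM !polyC_natr.
rewrite coefCM coef_euler; case: n => [|n] /=; first by rewrite !(mul0r, mulr0, subr0).
by rewrite coefB coef_euler -polyC_natr coefCM; ring.
Qed.

Lemma coef_qop00 (p : {poly R}) : (qop l 0 p)`_0 = 0.
Proof. by rewrite coef_qop0 !mul0r subr0. Qed.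
End BesselOperatorCoef.

(** * Orthogonality of the N_j *)

Section Gram.
Variables (R : numFieldType) (l b : nat).
Hypothesis lb : (l <= b)%N.
Local Notation N := (Npol R l b).
Local Notation D := (N 0).
Local Notation e := (2 * (b - l) + 1)%N.
Local Notation Q := (@qop R l).

Definition gram j k := lapl ('X^e * (N j * N k)).

Lemma gramC j k : gram j k = gram k j.
Proof. by rewrite /gram mulrC [N j * _]mulrC mulrC. Qed.

(** Lagrange's identity: [Q (2 * b + 1)] is the formal adjoint of [Q 0] for x^(2(b-l)-1) e^(-x), so
    pairing D with the eigenvalue equation moves the operator onto D, where it vanishes. The
    eigenvalue of index j+1 is nonzero. *)
Lemma gram0S j : gram 0 j.+1 = 0.
Proof.
have eD := Q_Npol0 R l b.
have eN := Npol_eigen R lb j.+1.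
set h := Q 0 (N j.+1) in eN.
have h0 : h`_0 = 0 by rewrite /h coef_qop00.
clearbody h.
pose m : {poly R} := (2 * b + 1)%:R.
(* The bilinear concomitant: D Q_{2b+1} h - h Q_0 D = 2(b-l) Y + theta Y - x Y. *)
pose Y : {poly R} := D * (m * h + euler h) - h * euler D.
pose W : {poly R} := 'X^(2 * (b - l)) * Y.
(* For b = l the power of x is trivial, and the boundary term vanishes through h(0) = 0. *)
have W0 : W`_0 = 0.
  have E0 (p : {poly R}) : (euler p)`_0 = 0 by rewrite coef_euler mul0r.
  rewrite coefMr big_ord1/=.
  rewrite /Y coefB !coefM !big_ord1 /= coefD coefM big_ord1 h0 !E0.
  by rewrite !(mulr0, mul0r, addr0, subr0).
have : lapl (W^`() - W) = 0 by rewrite laplB lapl_deriv W0 subr0 subrr.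
have -> : W^`() - W = (j.+1%:R * (j.+1%:R + 2 * (b%:R + 1))) * ('X^e * (D * N j.+1)).
  apply: (@mulfI _ 'X); first by rewrite polyX_eq0.
  transitivity (euler W - 'X * W); first by rewrite /euler; ring.
  have -> : euler W - 'X * W = 'X^(2 * (b - l)) * ((2 * (b%:R - l%:R)) * Y + euler Y - 'X * Y).
    by rewrite /W eulerM eulerXn natrM natrB//; ring.
  transitivity ('X^(2 * (b - l)) * (D * Q (2 * b + 1) h)).
    congr (_ * _). rewrite /Y eulerB (eulerM D) (eulerM h) eulerD (eulerM m) /m euler_nat.
    have : euler (euler D) = (2 * l%:R + 1) * euler D + 'X * (euler D - l%:R * D).
      by move/eqP: eD; rewrite /qop !mul0r !addr0 -addrA -opprD subr_eq0 => /eqP.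
    move=> ->; rewrite /qop eulerD (eulerM _%:R h) euler_nat natrD natrM.
    ring.
  by rewrite eN (exprD _ (2 * (b - l)) 1) expr1; ring.
have -> : j.+1%:R * (j.+1%:R + 2 * (b%:R + 1)) = (j.+1 * (j.+1 + 2 * b.+1))%:R :> {poly R}.
  by rewrite natrM natrD natrM natr1.
by rewrite lapl_nat => /eqP; rewrite mulf_eq0 pnatr_eq0 => /eqP.
Qed.

(** The sum of both sides integrates a total derivative, because 2(b+1-l) is the weight exponent
    plus one; this fixes the shift b+1-l in T. *)
Lemma lapl_skew (p q : {poly R}) :
  lapl ('X^e * ((2 * (euler p + (b%:R + 1 - l%:R) * p) - 'X * p) * q)) =
  - lapl ('X^e * (p * (2 * (euler q + (b%:R + 1 - l%:R) * q) - 'X * q))).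
Proof.
apply/eqP; rewrite -addr_eq0 -laplD; apply/eqP.
rewrite -[RHS](lapl_euler e (2%:R * (p * q))); congr lapl.
rewrite eulerM euler_nat eulerM natrD natrM natrB//; ring.
Qed.

Definition ladder_up j : R := (j%:R + 1) * (j%:R + 2 * (b%:R + 1)) / (j%:R + b%:R + 1).
Definition ladder_down j : R := (j%:R + b%:R + 1 + l%:R) * (j%:R + b%:R - l%:R) / (j%:R + b%:R + 1).

Lemma ladder_den_neq0 j : j%:R + b%:R + 1 != 0 :> R.
Proof. by rewrite -natrD natr1 pnatr_eq0. Qed.

Lemma ladder_up_neq0 j : ladder_up j != 0.
Proof.
by rewrite /ladder_up !mulf_neq0 ?invr_eq0 ?ladder_den_neq0 ?natr1//.
Qed.

Lemma ladder0 : 2 * (euler D + (b%:R + 1 - l%:R) * D) - 'X * D = ladder_up 0 *: N 1.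
Proof.
have h : (b%:R + 1 : {poly R}) != 0 by rewrite natr1 -polyC_natr polyC_eq0 pnatr_eq0.
apply: (mulfI h); transitivity (2 * (b%:R + 1) * N 1).
  rewrite -(Npol_ladder0 R lb); ring.
rewrite -scalerAr -mul_polyC (_ : ladder_up 0 = 2); last first.
  by rewrite /ladder_up mulr0n !add0r mul1r mulfK// natr1 pnatr_eq0.
by rewrite polyC_natr; ring.
Qed.

Lemma ladder j : 2 * (euler (N j.+1) + (b%:R + 1 - l%:R) * N j.+1) - 'X * N j.+1 =
  ladder_up j.+1 *: N j.+2 - ladder_down j.+1 *: N j.
Proof.
have h : (j.+1%:R + b%:R + 1 : {poly R}) = (j.+1%:R + b%:R + 1)%:P.
  by rewrite !polyCD !polyC_natr.
have h0 : (j.+1%:R + b%:R + 1 : {poly R}) != 0 by rewrite h polyC_eq0 ladder_den_neq0.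
apply: (mulfI h0).
have E := Npol_ladder R lb j.
transitivity (j.+2%:R * (j.+1%:R + 2 * (b%:R + 1)) * N j.+2
   - (j.+1%:R + b%:R + 1 + l%:R) * (j.+1%:R + b%:R - l%:R) * N j).
  by rewrite -E; ring.
have Ea : (j.+1%:R + b%:R + 1) * (ladder_up j.+1)%:P = j.+2%:R *
  (j.+1%:R + 2 * (b%:R + 1)) :> {poly R}.
  rewrite h -polyCM /ladder_up mulrC divfK ?ladder_den_neq0//.
  by rewrite !(polyCM, polyCD) !polyC_natr polyC1; ring.
have Eb : (j.+1%:R + b%:R + 1) * (ladder_down j.+1)%:P =
    (j.+1%:R + b%:R + 1 + l%:R) * (j.+1%:R + b%:R - l%:R) :> {poly R}.
  rewrite h -polyCM /ladder_down mulrC divfK ?ladder_den_neq0//.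
  by rewrite !(polyCM, polyCB, polyCD) !polyC_natr polyC1; ring.
by rewrite -!mul_polyC -Ea -Eb; ring.
Qed.

(** Skew-adjointness applied to N_{j+1} and N_k, with both images under T expanded by the ladder;
    for k = 0 the lowering term is absent. *)
Lemma gram_rec k j :
  ladder_up j.+1 * gram j.+2 k - ladder_down j.+1 * gram j k
  + (ladder_up k * gram j.+1 k.+1 - (if k is k'.+1 then ladder_down k * gram j.+1 k' else 0)) = 0.
Proof.
have := lapl_skew (N j.+1) (N k); rewrite ladder.
move=> /eqP; rewrite -addr_eq0 => /eqP; rewrite mulrBl mulrBr laplB.
rewrite -!(scalerAl _ (N _)) -!(scalerAr _ 'X^_) !laplZ.
case: k => [|k]; first by rewrite ladder0 -(scalerAr _ (N _)) -(scalerAr _ 'X^_) laplZ subr0.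
by rewrite ladder mulrBr mulrBr laplB -!(scalerAr _ (N _)) -!(scalerAr _ 'X^_) !laplZ.
Qed.

(** [gram_rec] is solved for its entry (j+1, k+1): the other three have smaller second index and
    stay off the diagonal on the same side, and [ladder_up] is never 0. *)
Lemma gram_lt k : forall j, (k < j)%N -> gram j k = 0.
Proof.
elim/ltn_ind: k => -[_ [//|j] _|k IH [//|j] kj]; first by rewrite gramC gram0S.
have := gram_rec k j.
rewrite (IH k _ j.+2) ?(IH k _ j); [|lia|lia|lia|lia].
rewrite !mulr0 subrr add0r.
case: k IH kj => [|k] IH kj /eqP.
  by rewrite subr0 mulf_eq0 (negPf (ladder_up_neq0 _)) => /eqP.
rewrite (IH k _ j.+1) ?mulr0 ?subr0; [|lia|lia].
by rewrite mulf_eq0 (negPf (ladder_up_neq0 _)) => /eqP.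
Qed.

Lemma gram_neq j k : j != k -> gram j k = 0.
Proof.
by case: ltngtP => // h _; [rewrite gramC|]; exact: gram_lt.
Qed.

(** [gram_rec] at j = k, where only two diagonal entries survive. *)
Lemma gram_diag k : ladder_up k * gram k.+1 k.+1 = ladder_down k.+1 * gram k k.
Proof.
have := gram_rec k k; rewrite (@gram_lt k k.+2)//.
rewrite mulr0 sub0r => /eqP; rewrite addrC subr_eq0.
case: k => [|k] /eqP; first by rewrite subr0.
by rewrite (@gram_lt k k.+2)// mulr0 subr0.
Qed.
End Gram.

(** * Moments of the squared Bessel polynomial *)

Section BesselPolynomial.
Variables (R : numFieldType) (l : nat).

Definition bessel_poly : {poly R} := \sum_(i < l.+1) bessel_coef R l i *: 'X^i.
Local Notation D := bessel_poly.
Definition bessel_moment s := lapl ('X^s * (D * D)).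

Lemma Npol0_bessel_poly b : Npol R l b 0 = D. Proof. exact: Npol0E. Qed.

Lemma bessel_poly_ode : euler (euler D) = (2 * l%:R + 1) * euler D + 'X * (euler D - l%:R * D).
Proof.
have := Q_Npol0 R l 0; rewrite Npol0_bessel_poly => /eqP.
by rewrite /qop mulr0n !mul0r !addr0 -addrA -opprD subr_eq0 => /eqP.
Qed.

Lemma coef0_bessel_poly : D`_0 = (2 * l)`!%:R / l`!%:R.
Proof.
rewrite /bessel_poly coef_sum big_ord_recl coefZ coefXn eqxx mulr1 big1 ?addr0.
  by rewrite /bessel_coef !subn0 fact0 mul1r.
by move=> i _; rewrite coefZ coefXn /= mulr0.
Qed.

(** With u = e^(-x/2) D one has e^(-x/2) V = 2 theta u. The integrals of x^s u^2, x^s u theta u and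
    x^s (theta u)^2 are tied by three integrations by parts, from which the last two are eliminated.
    The step is two because theta^2 u = (2l+1) theta u + x^2 u / 4 involves x^2 only. *)
Lemma bessel_moment_rec s : (s%:R + 2 * l%:R + 3) * bessel_moment s.+2 =
  (s%:R + 2 * l%:R + 2) * (s%:R + 1) * (s%:R + 4 * l%:R + 3) * bessel_moment s.
Proof.
pose V := 2 * euler D - 'X * D.
have eV : euler V = (2 * (2 * l%:R + 1) + 'X) * euler D - (2 * l%:R + 1) * ('X * D).
  by rewrite /V eulerB (eulerM 2%:R) bessel_poly_ode (eulerM 'X) (@euler_nat R 2) eulerX; ring.
have := lapl_euler s (D * D); rewrite eulerM => E1.
have := lapl_euler s (D * V); rewrite (eulerM D) eV => E2.
have := lapl_euler s (V * V); rewrite (eulerM V) eV => E3.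
pose A := bessel_moment s. pose A2 := bessel_moment s.+2.
pose B := lapl ('X^s * (D * V)). pose B2 := lapl ('X^(s.+2) * (D * V)).
pose C := lapl ('X^s * (V * V)).
have F1 t : (t%:R + 1) * bessel_moment t + lapl ('X^t * (D * V)) = 0.
  rewrite -[RHS](lapl_euler t (D * D)) eulerM /bessel_moment natr1 -lapl_nat -laplD; congr lapl.
  rewrite /V -natr1; ring.
have F2 : 2 * (s%:R + 2 * l%:R + 2) * B + C + A2 = 0.
  rewrite -[RHS](mulr0 2%:R) -E2.
  have -> : 2 * (s%:R + 2 * l%:R + 2) = (2 * (s + 2 * l + 2))%:R :> R by rewrite !(natrM, natrD).
  rewrite -!lapl_nat -!laplD; congr lapl.
  by rewrite !(natrM, natrD) /V !exprS; ring.
have F3 : (s%:R + 4 * l%:R + 3) * C + B2 = 0.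
  rewrite -E3.
  have -> : (s%:R + 4 * l%:R + 3) = (s + 4 * l + 3)%:R :> R by rewrite !(natrM, natrD).
  rewrite -!lapl_nat -!laplD; congr lapl.
  by rewrite !(natrM, natrD) /V !exprS; ring.
have := F1 s; have := F1 s.+2; rewrite -/B -/B2 -/A -/A2 => G2 G1.
have eB : B = - ((s%:R + 1) * A) by apply/eqP; rewrite -addr_eq0 addrC G1.
have eB2 : B2 = - ((s%:R + 3) * A2).
  by apply/eqP; rewrite -subr_eq0 -G2 -!natr1; apply/eqP; ring.
have eC : C = - A2 - 2 * (s%:R + 2 * l%:R + 2) * B.
  by apply/eqP; rewrite -subr_eq0 -F2; apply/eqP; ring.
move: F3; rewrite eC eB2 eB => F3.
apply: (@mulfI _ (2 : R)); first by rewrite pnatr_eq0.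
apply/eqP; rewrite eq_sym -subr_eq0 -F3; apply/eqP; ring.
Qed.

(** The recursion at s = -1 read as a limit: (s+1) times the moment of order s becomes D(0)^2, which
    enters here through boundary terms. The polynomial [v] is V/x. *)
Lemma bessel_moment1 : (l%:R + 1) * bessel_moment 1 = (2 * l%:R + 1) ^+ 2 * D`_0 ^+ 2.
Proof.
pose v := 2 * D^`() - D.
have ev : 'X * v^`() = (2 * l%:R) * v + 'X * D^`().
  apply: (@mulfI _ 'X); first by rewrite polyX_eq0.
  have := bessel_poly_ode; rewrite /euler derivM derivX => E.
  rewrite {1}/v derivB derivM -polyC_natr derivC.
  transitivity (2 * ('X * (1 * D^`() + 'X * D^`()^`())) - 2 * ('X * D^`()) - 'X * 'X * D^`()).
    rewrite polyC_natr; ring.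
  by rewrite E polyC_natr /v; ring.
have eD : 2 * D^`() = v + D by rewrite /v subrK.
have stokes (W : {poly R}) : lapl (W^`() - W) = - W`_0.
  by rewrite laplB lapl_deriv addrC addKr.
have H1 : lapl (D * v) = - D`_0 ^+ 2.
  rewrite expr2 -[in RHS](coef0M D D) -stokes; congr lapl; rewrite derivM /v; ring.
have H2 : 2 * (2 * l%:R + 1) * lapl (D * v) + lapl ('X * (v * v)) + bessel_moment 1 = 0.
  transitivity (lapl (2%:R * (('X * (D * v))^`() - 'X * (D * v)))); last first.
    by rewrite lapl_nat stokes coefXM oppr0 mulr0.
  have -> : 2 * (2 * l%:R + 1) = (2 * (2 * l + 1))%:R :> R by rewrite !(natrM, natrD).
  rewrite -lapl_nat -!laplD; congr lapl; rewrite !derivM derivX.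
  rewrite expr1 !(natrM, natrD).
  transitivity (2 * (D * v) + 2 * D^`() * 'X * v + 2 * D * ('X * v^`()) - 2 * ('X * (D * v)));
    last by ring.
  rewrite ev; transitivity ((2 + 4 * l%:R) * (D * v) + 'X * v * (2 * D^`()) + 'X * D *
    (2 * D^`()) - 2 * ('X * (D * v))); last by ring.
  by rewrite eD; ring.
have H3 : (4 * l%:R + 2) * lapl ('X * (v * v)) - 2 * bessel_moment 1 = 0.
  transitivity (lapl (('X * ('X * (v * v)))^`() - 'X * ('X * (v * v))
     - (('X * ('X * (D * D)))^`() - 'X * ('X * (D * D))))); last first.
    by rewrite laplB !stokes !coefXM oppr0 subrr.
  have -> : (4 * l%:R + 2) = (4 * l + 2)%:R :> R by rewrite !(natrM, natrD).
  rewrite -!lapl_nat -!laplB; congr lapl; rewrite !derivM derivX.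
  rewrite expr1 !(natrM, natrD).
  transitivity (2 * ('X * (v * v)) + 2 * 'X * v * ('X * v^`()) - 'X * ('X * (v * v))
    - 2 * ('X * (D * D)) - 'X * 'X * D * (2 * D^`()) + 'X * 'X * D * D); last by ring.
  rewrite ev; transitivity ((2 + 4 * l%:R) * ('X * (v * v)) + 'X * 'X * v * (2 * D^`()) - 'X *
    ('X * (v * v))
    - 2 * ('X * (D * D)) - 'X * 'X * D * (2 * D^`()) + 'X * 'X * D * D); last by ring.
  by rewrite eD; ring.
rewrite H1 in H2.
set c := lapl ('X * (v * v)) in H2 H3.
have ec : c = 2 * (2 * l%:R + 1) * D`_0 ^+ 2 - bessel_moment 1.
  by apply/eqP; rewrite -subr_eq0 -[X in _ == X]H2; apply/eqP; ring.
move: H3; rewrite ec => H3.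
apply: (@mulfI _ (- 4 : R)); first by rewrite oppr_eq0 pnatr_eq0.
apply/eqP; rewrite -subr_eq0 -[X in _ == X]H3; apply/eqP; ring.
Qed.

(** Odd orders suffice, since the weight exponent 2(b-l)+1 is odd. *)
Lemma bessel_moment_odd n : bessel_moment (2 * n + 1) * ((l + n + 1)`! * (l + n)`!)%:R =
  ((2 * (l + n) + 1)`! * (2 * l + n + 1)`! * n`!)%:R.
Proof.
have h m : m.+1%:R != 0 :> R by rewrite pnatr_eq0.
have fn0 m : m`!%:R != 0 :> R by rewrite pnatr_eq0 -lt0n fact_gt0.
elim: n => [|n IH].
  rewrite muln0 add0n !addn0 fact0 muln1 !addn1 !factS !natrM.
  have := bessel_moment1; rewrite coef0_bessel_poly => E.
  transitivity (((l%:R + 1) * bessel_moment 1) * (l`!%:R * l`!%:R)); first by rewrite -natr1; ring.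
  rewrite E -!natr1 natrM; field; exact: fn0.
have E := bessel_moment_rec (2 * n + 1).
have -> : (2 * n.+1 + 1 = (2 * n + 1).+2)%N by lia.
have -> : (2 * (l + n.+1) + 1 = (2 * (l + n) + 1).+2)%N by lia.
have -> : (2 * l + n.+1 + 1 = (2 * l + n + 1).+1)%N by lia.
have -> : (l + n.+1 + 1 = (l + n + 1).+1)%N by lia.
have -> : (l + n.+1 = (l + n).+1)%N by lia.
rewrite !factS !natrM in IH *.
have h2 : ((2 * n + 1)%:R + 2 * l%:R + 3) != 0 :> R.
  by rewrite -natrM -!natrD pnatr_eq0 addnS.
apply: (mulfI h2); rewrite [LHS]mulrA E.
have -> : forall x y z t u : R, x * y * z * bessel_moment (2 * n + 1) *
  (t * (l + n + 1)`!%:R * (u * (l + n)`!%:R)) =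
   x * y * z * t * u * (bessel_moment (2 * n + 1) * ((l + n + 1)`!%:R * (l + n)`!%:R)) by move=> *;
     ring.
rewrite IH -!natr1 !(natrM, natrD); ring.
Qed.

End BesselPolynomial.

Section GramClosedForm.
Variables (R : numFieldType) (l b : nat).
Hypothesis lb : (l <= b)%N.

(** The base case is the moment with n = b-l, the step is the ratio of norms in [gram_diag];
    denominators are cleared so that the induction runs on products of factorials. *)
Lemma gram_closed j : gram R l b j j *
   ((j + 2 * b + 1)`! * j`! * (j + b + 1) * b`! ^ 2)%:R =
   ((2 * b + 1)`! ^ 2 * (j + l + b + 1)`! * (j + b - l)`!)%:R.
Proof.
have h m : m.+1%:R != 0 :> R by rewrite pnatr_eq0.
elim: j => [|j IH].
  have := bessel_moment_odd R l (b - l); rewrite /bessel_moment -(Npol0_bessel_poly R l b) subnKC//.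
  rewrite -/(gram R l b 0 0) !add0n => E.
  have bl : (2 * l + (b - l) + 1 = l + b + 1)%N by lia.
  rewrite bl in E.
  rewrite fact0 muln1.
  have -> : ((2 * b + 1)`! * (b + 1) * b`! ^ 2 = (2 * b + 1)`! * ((b + 1)`! * b`!))%N.
    have -> : ((b + 1)`! = (b + 1) * b`!)%N by rewrite addn1 factS.
    by rewrite -mulnn; ring.
  by rewrite natrM mulrCA E !natrM; ring.
have := gram_diag R lb j; rewrite /ladder_up /ladder_down => E.
have -> : (j.+1 + 2 * b + 1 = (j + 2 * b + 1).+1)%N by lia.
have -> : (j.+1 + b + 1 = (j + b + 1).+1)%N by lia.
have -> : (j.+1 + l + b + 1 = (j + l + b + 1).+1)%N by lia.
have -> : (j.+1 + b - l = (j + b - l).+1)%N by lia.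
have E' : gram R l b j.+1 j.+1 * ((j%:R + 1) * (j%:R + 2 * (b%:R + 1)) * (j%:R + b%:R + 2)) =
  (j%:R + b%:R + 2 + l%:R) * (j%:R + 1 + b%:R - l%:R) * (j%:R + b%:R + 1) * gram R l b j j.
  have j1 : j%:R + b%:R + 1 != 0 :> R by exact: ladder_den_neq0.
  have j2 : j%:R + b%:R + 2 != 0 :> R by rewrite -!natrD pnatr_eq0 addnS.
  transitivity ((j%:R + b%:R + 1) * (j%:R + b%:R + 2) *
    ((j%:R + 1) * (j%:R + 2 * (b%:R + 1)) / (j%:R + b%:R + 1) * gram R l b j.+1 j.+1)).
    by field.
  rewrite E -[j.+1%:R]natr1; field.
  by rewrite (_ : j%:R + 1 + b%:R + 1 = j%:R + b%:R + 2)//; ring.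
rewrite !factS !natrM; rewrite !natrM in IH.
transitivity ((gram R l b j.+1 j.+1 * ((j%:R + 1) * (j%:R + 2 * (b%:R + 1)) * (j%:R + b%:R + 2)))
  * ((j + 2 * b + 1)`!%:R * j`!%:R * (b`!%:R * b`!%:R))).
  by rewrite -!natr1 !(natrM, natrD); ring.
rewrite E'.
transitivity ((j%:R + b%:R + 2 + l%:R) * (j%:R + 1 + b%:R - l%:R) *
 (gram R l b j j * ((j + 2 * b + 1)`!%:R * j`!%:R * (j + b + 1)%:R * (b`!%:R * b`!%:R)))).
  by rewrite !natrD; ring.
rewrite IH -!natr1 !natrD natrB ?natrD; last by lia.
ring.
Qed.
End GramClosedForm.

(** * Span of the polynomials N_j *)

Section HalfExpTaylor.
Variable R : numFieldType.

Definition half_exp_coef i : R := (- 2^-1) ^+ i / i`!%:R.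
(* Taylor coefficient of order n of p(x) e^{-x/2} *)
Definition tau n (p : {poly R}) : R := \sum_(i < n.+1) half_exp_coef i * p`_(n - i).

Lemma half_exp_coefS i : i.+1%:R * half_exp_coef i.+1 = - 2^-1 * half_exp_coef i.
Proof.
rewrite /half_exp_coef factS natrM exprS; field.
by rewrite nat1r pnatr_eq0 pnatr_eq0 -lt0n fact_gt0.
Qed.

Lemma tauD n p q : tau n (p + q) = tau n p + tau n q.
Proof. by rewrite -big_split; apply: eq_bigr => i _; rewrite coefD mulrDr. Qed.
Lemma tauZ n c p : tau n (c *: p) = c * tau n p.
Proof. by rewrite mulr_sumr; apply: eq_bigr => i _; rewrite coefZ mulrCA. Qed.
Lemma tauN n p : tau n (- p) = - tau n p.
Proof. by rewrite -scaleN1r tauZ mulN1r. Qed.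
Lemma tauB n p q : tau n (p - q) = tau n p - tau n q.
Proof. by rewrite tauD tauN. Qed.
Lemma tauMn n c p : tau n (c%:R * p) = c%:R * tau n p.
Proof. by rewrite natr_mul_poly tauZ. Qed.

Lemma tauX n p : tau n ('X * p) = if n is k.+1 then tau k p else 0.
Proof.
case: n => [|n]; first by rewrite /tau big_ord1 coefXM mulr0.
rewrite /tau big_ord_recr /= subnn coefXM mulr0 addr0.
by apply: eq_bigr => i _; rewrite coefXM subSn//= -ltnS.
Qed.

(** On p e^(-x/2) the operator 2 theta - x acts as 2 theta, which multiplies the Taylor coefficient
    of order n by 2n. *)
Lemma tau_euler n p : tau n (2 * euler p - 'X * p) = 2 * (n%:R * tau n p).
Proof.
rewrite tauB tauMn; apply/eqP; rewrite subr_eq addrC -subr_eq -mulrBr; apply/eqP.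
rewrite (tauX n p).
case: n => [|n].
  by rewrite /tau !big_ord1 coef_euler !mul0r mulr0 subrr mulr0.
rewrite [in RHS]/tau.
have -> : tau n.+1 (euler p) - n.+1%:R * tau n.+1 p =
  \sum_(i < n.+2) (- (i%:R * half_exp_coef i * p`_(n.+1 - i))).
  rewrite /tau mulr_sumr -sumrB; apply: eq_bigr => i _.
  by rewrite coef_euler natrB ?(leq_ord i)//; ring.
rewrite big_ord_recl !mul0r oppr0 add0r mulr_sumr; apply: eq_bigr => i _.
by rewrite lift0 half_exp_coefS subSS; field.
Qed.

Variable l : nat.
(** After multiplication by e^(-x/2) the operator becomes (theta+m)(theta+m-2l-1) - x^2/4, which
    preserves parity; hence odd orders can be treated alone. *)
Lemma tau_qop m n p : tau n (qop l m p) =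
  (n + m)%:R * ((n + m)%:R - 2 * l%:R - 1) * tau n p
   - 4^-1 * (if n is k.+2 then tau k p else 0).
Proof.
have [T TE] : exists T, forall q : {poly R}, T q = 2 * euler q - 'X * q by eexists.
have tT n' q : tau n' (T q) = 2 * (n'%:R * tau n' q) by rewrite TE tau_euler.
have : 4%:R * qop l m p = T (T p) + (4 * m)%:R * T p + (4 * m ^ 2)%:R * p
   - 2%:R * ((2 * l + 1)%:R * T p) - (4 * (2 * l + 1) * m)%:R * p - 'X * ('X * p).
  have tp : euler (T p) = 2 * euler (euler p) - 'X * p - 'X * euler p.
    by rewrite TE eulerB (eulerM 2%:R) (eulerM 'X p) (@euler_nat R 2) eulerX; ring.
  rewrite (TE (T p)) tp (TE p) /qop eulerD (eulerM _%:R p) euler_nat !(natrM, natrD); ring.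
have XX : tau n ('X * ('X * p)) = if n is k.+2 then tau k p else 0.
  by rewrite tauX; case: n => [//|n]; rewrite tauX.
move/(congr1 (tau n)); rewrite tauMn => E.
apply: (@mulfI _ (4 : R)); first by rewrite pnatr_eq0.
rewrite E !(tauB, tauD, tauMn, tT) XX !(natrM, natrD). by case: n {E XX} => [|[|n]]; field.
Qed.

(** These are l conditions on a space of dimension at most l. By induction on s: [qop l 0 r] is
    divisible by x^2, and the quotient is shorter and inherits the conditions, so it is 0; then
    [qop l 0 r = 0] kills the top coefficient of r. *)
Lemma odd_tau_eq0 s (r : {poly R}) : (s <= l)%N -> (size r <= s)%N ->
  (forall n, odd n -> (n < 2 * l)%N -> tau n r = 0) -> r = 0.
Proof.
elim: s r => [|s IH] r sl rs h; first by apply/eqP; rewrite -size_poly_leq0.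
have t0 : (qop l 0 r)`_0 = 0 by exact: coef_qop00.
have t1 : (qop l 0 r)`_1 = 0.
  have : tau 1 (qop l 0 r) = 0 by rewrite tau_qop h// ?mulr0 ?subrr//; lia.
  by rewrite /tau big_ord_recl big_ord1/= t0 mulr0 addr0 /half_exp_coef expr0 fact0 divr1 mul1r.
pose r' := drop_poly 2 (qop l 0 r).
have Er : qop l 0 r = 'X * ('X * r').
  rewrite /r'; apply/polyP => -[|[|n]]; rewrite !coefXM//= ?t0 ?t1//.
  by rewrite coef_drop_poly addn2.
have r'0 : r' = 0.
  apply: IH; first exact: ltnW.
    apply/leq_sizeP => n sn; rewrite coef_drop_poly addn2 coef_qop0.
    have rn k : (s < k)%N -> r`_k = 0 by move=> sk; rewrite nth_default// (leq_trans rs).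
    by rewrite !rn ?mulr0 ?subrr// ltnS ltnW.
  move=> n on nl; have := tau_qop 0 n.+2 r; rewrite Er !tauX => ->.
  rewrite (h n)// mulr0 subr0.
  have [nl2|nl2] := ltnP n.+2 (2 * l); first by rewrite h ?mulr0//= negbK.
  (* At the end of the range, n+2 = 2l+1 is the second indicial exponent, and the unknown
     coefficient is multiplied by 0. *)
  have E : (2 * l = n.+1)%N.
    by move: on; rewrite -[n]odd_double_half; lia.
  rewrite (_ : (n.+2 + 0)%:R - 2 * l%:R - 1 = 0 :> R) ?mulr0 ?mul0r//.
  by rewrite -natrM E addn0; ring.
rewrite r'0 !mulr0 in Er.
(* This coefficient is (l - s) times the coefficient of order s of r, and s < l. *)
have : (qop l 0 r)`_s.+1 = 0 by rewrite Er coef0.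
rewrite coef_qop0 nth_default ?mulr0 ?sub0r; last exact: leq_trans rs _.
move/eqP; rewrite oppr_eq0 mulf_eq0 subr_eq0 eqr_nat ltn_eqF//= => /eqP rs0.
apply: IH h; first exact: ltnW.
apply/leq_sizeP => k; rewrite leq_eqVlt => /orP[/eqP <-//|sk].
by rewrite nth_default// (leq_trans rs).
Qed.

Variables (b : nat).
Hypothesis lb : (l <= b)%N.
Local Notation N := (Npol R l b).

(** The eigenvalue equation multiplies the coefficient of order n by n (n-2l-1) (n+2b+1) (n+2b-2l)
    and adds terms of orders n-2 and n-4, zero by induction. The product is nonzero for odd n below
    2l; at n = 0 it vanishes, so the argument does not start on even orders. *)
Lemma tau_Npol j n : odd n -> (n < 2 * l)%N -> tau n (N j) = 0.
Proof.
have E := Npol_eigen R lb j.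
elim/ltn_ind: n => n IH on nl.
have : tau n (qop l (2 * b + 1) (qop l 0 (N j))) = 0.
  rewrite E.
  have -> : j%:R * (j%:R + 2 * (b%:R + 1)) * ('X^2 * N j) = (j * (j + 2 * (b + 1)))%:R *
    ('X * ('X * N j)) :> {poly R}.
    by rewrite !(natrM, natrD); ring.
  rewrite tauMn tauX; case: n IH on nl => [//|[|n]] IH on nl; first by rewrite tauX mulr0.
  by rewrite tauX IH ?mulr0//; [rewrite /= negbK in on|exact: ltn_trans nl].
rewrite !tau_qop.
have -> : 4^-1 * (if n is k.+2 then tau k (qop l 0 (N j)) else 0) = 0.
  case: n IH on nl => [//|[|n]] IH on nl; first by rewrite mulr0.
  have on' : odd n by rewrite /= negbK in on.
  rewrite tau_qop IH//; last exact: ltn_trans nl.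
  rewrite mulr0 sub0r; case: n on' IH on nl => [//|[|n]] on' IH on nl;
    first by rewrite !mulr0 oppr0 mulr0.
  rewrite IH; [by rewrite !mulr0 oppr0 mulr0|lia|by rewrite /= negbK in on'|lia].
have -> : 4^-1 * (if n is k.+2 then tau k (N j) else 0) = 0.
  case: n IH on nl => [//|[|n]] IH on nl; first by rewrite mulr0.
  by rewrite IH ?mulr0//; [rewrite /= negbK in on|exact: ltn_trans nl].
rewrite !subr0 addn0 => /eqP; rewrite mulf_eq0 => /orP[|].
  have -> : (n + (2 * b + 1))%:R - 2 * l%:R - 1 = (n + 2 * b - 2 * l)%:R :> R.
    by rewrite natrB; [rewrite !(natrM, natrD); ring|lia].
  rewrite -natrM pnatr_eq0 muln_eq0; have n0 : (0 < n)%N by case: (n) on.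
  by move=> h; exfalso; move: h; lia.
rewrite !mulf_eq0 => /orP[|/eqP//].
have -> : n%:R - 2 * l%:R - 1 = - (2 * l + 1 - n)%:R :> R.
  by rewrite natrB ?natrD ?natrM; [ring|lia].
by rewrite oppr_eq0 !pnatr_eq0; have n0 : (0 < n)%N by [case: (n) on]; move=> h; exfalso; move: h;
  lia.
Qed.

Lemma span_Npol (p : {poly R}) : (forall n, odd n -> (n < 2 * l)%N -> tau n p = 0) ->
  exists n (c : nat -> R), p = \sum_(j < n) c j *: N j.
Proof.
have [s] := ubnP (size p); elim: s p => // s IH p ps tp.
have [pl|pl] := leqP (size p) l.
  exists 0, (fun=> 0); rewrite big_ord0.
  by apply: (@odd_tau_eq0 l).
(* The index with deg N_m = deg p, available while deg p >= l. *)
pose m := (size p - l.+1)%N.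
have sN : size (N m) = size p by rewrite size_Npol /m; move: pl; lia.
have lN : lead_coef (N m) != 0 by rewrite lead_coef_eq0 -size_poly_eq0 sN -lt0n (leq_trans _ pl).
pose c0 := lead_coef p / lead_coef (N m).
have [||n [c Ec]] := IH (p - c0 *: N m).
- rewrite ltnS in ps; apply: leq_trans ps.
  have p0 : size p = (size p).-1.+1 by rewrite prednK// (leq_trans _ pl).
  rewrite [X in (_ < X)%N]p0 ltnS; apply/leq_sizeP => k.
  rewrite leq_eqVlt => /orP[/eqP <-|kp].
    rewrite coefB coefZ -[in X in _ - _ * X]sN -!lead_coefE.
    by rewrite /c0 divfK// subrr.
  by rewrite coefB coefZ !nth_default ?mulr0 ?subrr//; rewrite ?sN p0.
- by move=> n on nl; rewrite tauB tauZ tau_Npol// tp// mulr0 subrr.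
exists (maxn n m.+1), (fun j => (if (j < n)%N then c j else 0) + (if j == m then c0 else 0)).
under eq_bigr do rewrite scalerDl.
rewrite big_split/=.
have -> : \sum_(i < maxn n m.+1) (if (i < n)%N then c i else 0) *: N i = \sum_(j < n) c j *: N j.
  rewrite (big_ord_widen _ (fun i => c i *: N i) (leq_maxl n m.+1)) [RHS]big_mkcond.
  by apply: eq_bigr => i _; case: ifP => //; rewrite scale0r.
have -> : \sum_(i < maxn n m.+1) (if i == m :> nat then c0 else 0) *: N i = c0 *: N m.
  rewrite (bigD1 (Ordinal (leq_maxr n m.+1)))//= eqxx [X in _ + X]big1 ?addr0//.
  by move=> i im; rewrite ifN ?scale0r//; apply: contraNneq im => im; apply/eqP/val_inj.
by rewrite -Ec subrK.
Qed.

Lemma span_XN (q : {poly R}) :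
  exists n (c : nat -> R), 'X^(2 * l) * q = \sum_(j < n) c j *: N j.
Proof.
apply: span_Npol => n _ nl; rewrite /tau big1// => i _.
by rewrite coefXnM ifT ?mulr0// (leq_ltn_trans (leq_subr _ _)).
Qed.
End HalfExpTaylor.

(** * Integrals on the half-line, Gamma and K at half-integers *)

Section PointwiseDerivatives.
Variable R : realType.
Implicit Types (f g : R -> R) (x a b : R).

Lemma der_eq f x a b : is_derive x 1 f a -> a = b -> is_derive x 1 f b.
Proof. by move=> h <-. Qed.
Lemma der_cst c x : is_derive x 1 (fun _ : R => c : R) 0.
Proof. exact: is_derive_cst. Qed.
Lemma der_id x : is_derive x 1 (fun t : R => t) 1.
Proof. exact: is_derive_id. Qed.
Lemma derD f g x a b : is_derive x 1 f a -> is_derive x 1 g b ->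
  is_derive x 1 (fun t => f t + g t) (a + b).
Proof. by move=> ? ?; exact: (@is_deriveD _ _ _ f g). Qed.
Lemma derN f x a : is_derive x 1 f a -> is_derive x 1 (fun t => - f t) (- a).
Proof. by move=> ?; exact: (@is_deriveN _ _ _ f). Qed.
Lemma derB f g x a b : is_derive x 1 f a -> is_derive x 1 g b ->
  is_derive x 1 (fun t => f t - g t) (a - b).
Proof. by move=> ? ?; exact: (@is_deriveB _ _ _ f g). Qed.
Lemma derM f g x a b : is_derive x 1 f a -> is_derive x 1 g b ->
  is_derive x 1 (fun t => f t * g t) (f x * b + g x * a).
Proof. by move=> ? ?; exact: (@is_deriveM _ _ f g). Qed.
Lemma derX f n x a : is_derive x 1 f a ->
  is_derive x 1 (fun t => f t ^+ n) (n%:R * f x ^+ n.-1 * a).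
Proof.
move=> h; suff -> : (fun t => f t ^+ n) = f ^+ n by exact: is_deriveX.
by apply/funext => t; elim: n => [|n IH]; rewrite ?expr0// !exprS IH.
Qed.
Lemma der_comp f g x a b : is_derive x 1 g b -> is_derive (g x) 1 f a ->
  is_derive x 1 (fun t => f (g t)) (a * b).
Proof. by move=> ? ?; exact: (@is_derive1_comp _ f g). Qed.
Lemma der_expR f x a : is_derive x 1 f a -> is_derive x 1 (fun t => expR (f t)) (expR (f x) * a).
Proof. by move=> ?; apply: (@der_comp expR). Qed.
Lemma derV f x a : f x != 0 -> is_derive x 1 f a ->
  is_derive x 1 (fun t => (f t)^-1) (- (f x) ^- 2 * a).
Proof. by move=> f0 fa; exact: (@is_deriveV _ f). Qed.
Lemma der_cvg f x a : is_derive x 1 f a -> {for x, continuous f}.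
Proof.
by move=> [/derivable1_diffP/differentiable_continuous].
Qed.
End PointwiseDerivatives.

Section HalfLine.
Variable R : realType.
Local Notation leb := (@lebesgue_measure R).

Lemma integral_cy_FTC (f F : R -> R) (l : R) :
  (forall x : R, 0 <= x -> 0 <= f x) ->
  {within `[0, +oo[, continuous f} ->
  F x @[x --> +oo] --> l ->
  (forall x : R, 0 < x -> is_derive x 1 F (f x)) -> F x @[x --> 0^'+] --> F 0 ->
  (\int[leb]_(x in `[0%R, +oo[) (f x)%:E = (l - F 0)%:E)%E.
Proof.
move=> f0 cf Fl dF F0; rewrite EFinB; apply: ge0_continuous_FTC2y => //.
- by move=> x /dF[].
- move=> x; rewrite in_itv/= andbT => /dF d.
  by rewrite derive1E; apply: (@derive_val _ _ _ _ _ _ _ d).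
Qed.

Lemma integral_oy_FTC (f F : R -> R) (l : R) :
  (forall x : R, 0 <= x -> 0 <= f x) ->
  {within `[0, +oo[, continuous f} ->
  F x @[x --> +oo] --> l ->
  (forall x : R, 0 < x -> is_derive x 1 F (f x)) -> F x @[x --> 0^'+] --> F 0 ->
  (\int[leb]_(x in `]0%R, +oo[) (f x)%:E = (l - F 0)%:E)%E.
Proof.
move=> f0 cf Fl dF F0; rewrite -(integral_cy_FTC f0 cf Fl dF F0).
rewrite integral_itv_obnd_cbnd//.
apply/measurable_EFinP; apply: open_continuous_measurable_fun => //.
by move: cf => /continuous_within_itvcyP[/in_continuous_mksetP cf _].
Qed.

Lemma cvg_exprn_expRN n : x ^+ n * expR (- x) @[x --> +oo] --> (0 : R).
Proof.
apply: (@squeeze_cvgr _ _ _ _ (fun=> 0) (fun x => n.+1`!%:R * x^-1)).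
- near=> x.
  have x0 : 0 < x by near: x; apply: nbhs_pinfty_gt; exact: num_real.
  apply/andP; split; first by rewrite mulr_ge0 ?expR_ge0 ?exprn_ge0 ?ltW.
  rewrite expRN ler_pdivrMr ?expR_gt0// mulrAC ler_pdivlMr// -exprSr.
  rewrite -ler_pdivrMl ?ltr0n ?fact_gt0// mulrC.
  by apply: le_trans (expR_ge1Dxn n (ltW x0)); rewrite lerDr.
- exact: cvg_cst.
- rewrite -[X in _ --> X](mulr0 n.+1`!%:R); apply: cvgMl_tmp.
  apply: (proj2 (@gtr0_cvgV0 R R +oo _ id _)); last exact: cvg_id.
  by apply: nbhs_pinfty_gt; exact: num_real.
Unshelve. all: by end_near. Qed.

Lemma is_derive_horner_expRN (p : {poly R}) (x : R) :
  is_derive x 1 (fun t => p.[t] * expR (- t)) ((p^`() - p).[x] * expR (- x)).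
Proof.
refine (der_eq (derM (is_derive_poly p x) (der_expR (derN (der_id x)))) _).
rewrite hornerD hornerN; ring.
Qed.

Lemma cvg_horner_expRN (p : {poly R}) : p.[x] * expR (- x) @[x --> +oo] --> (0 : R).
Proof.
have -> : (fun x => p.[x] * expR (- x)) = (fun x => \sum_(i < size p) p`_i * (x ^+ i * expR (- x))).
  by apply/funext => x; rewrite horner_coef mulr_suml; apply: eq_bigr => i _; rewrite mulrA.
elim: (size p) => [|n IH].
  by under eq_fun do rewrite big_ord0; exact: cvg_cst.
under eq_fun do rewrite big_ord_recr /=.
have := cvgD IH (@cvgMl_tmp _ _ _ _ _ p`_n _ (cvg_exprn_expRN n)).
by rewrite mulr0 addr0; apply.
Qed.

Lemma continuous_horner_expRN (p : {poly R}) : continuous (fun x => p.[x] * expR (- x)).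
Proof. by move=> x; exact: (der_cvg (is_derive_horner_expRN p x)). Qed.

Lemma integral_Xn_expRN n :
  (\int[leb]_(x in `]0%R, +oo[) (x ^+ n * expR (- x))%:E = n`!%:R%:E)%E.
Proof.
(* Then q e^(-x) is a primitive of x^n e^(-x), with limit 0 at infinity and value -n! at 0. *)
have [q [q0 Eq]] : exists q : {poly R}, q`_0 = - n`!%:R /\ q^`() - q = 'X^n.
  elim: n => [|n [q [q0 Eq]]].
    exists (- 1); rewrite coefN coef1 fact0; split=> //.
    by rewrite derivN -polyC1 derivC oppr0 sub0r opprK expr0.
  exists (- 'X^(n.+1) + n.+1%:R *: q); rewrite coefD coefN coefXn coefZ q0 factS natrM.
  split; first by rewrite oppr0 add0r mulrN.
  rewrite derivD derivN derivZ derivXn.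
  rewrite opprD opprK addrACA -scalerBr Eq/= [_ *+ n.+1]mulrSr.
  rewrite scaler_nat mulrSr; ring.
have -> : n`!%:R = 0 - q.[0] * expR (- 0).
  by rewrite oppr0 expR0 mulr1 sub0r horner_coef0 q0 opprK.
apply: (@integral_oy_FTC _ (fun x => q.[x] * expR (- x))).
- by move=> x x0; rewrite mulr_ge0 ?exprn_ge0 ?expR_ge0.
- apply: continuous_subspaceT.
  have -> : (fun x : R => x ^+ n * expR (- x)) = (fun x => 'X^n.[x] * expR (- x)).
    by apply/funext => x; rewrite hornerXn.
  exact: continuous_horner_expRN.
- exact: cvg_horner_expRN.
- by move=> x _; have := is_derive_horner_expRN q x; rewrite Eq hornerXn.
- apply: cvg_at_right_filter; exact: continuous_horner_expRN.
Qed.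

Lemma integrable_Xn_expRN n :
  leb.-integrable (`]0%R, +oo[ : set R) (fun x => (x ^+ n * expR (- x))%:E).
Proof.
have m : measurable_fun (`]0%R, +oo[ : set R) (fun x : R => (x ^+ n * expR (- x))%:E).
  apply/measurable_EFinP; apply: measurable_funTS; apply: continuous_measurable_fun.
  have -> : (fun x : R => x ^+ n * expR (- x)) = (fun x => 'X^n.[x] * expR (- x)).
    by apply/funext => x; rewrite hornerXn.
  exact: continuous_horner_expRN.
apply/integrableP; split => //.
under eq_integral => x x0.
  rewrite gee0_abs; last first.
    move: x0; rewrite inE/= in_itv/= andbT => x0.
    by rewrite lee_fin mulr_ge0 ?exprn_ge0 ?expR_ge0 ?ltW.
  over.
by rewrite integral_Xn_expRN ltry.
Qed.

Lemma horner_expRN_sum (p : {poly R}) : (fun x => (p.[x] * expR (- x))%:E) =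
  (fun x => \sum_(i < size p) (p`_i)%:E * (x ^+ i * expR (- x))%:E)%E.
Proof.
apply/funext => x.
rewrite horner_coef mulr_suml -sumEFin; apply: eq_bigr => i _.
by rewrite -EFinM mulrA.
Qed.

Lemma integrable_horner_expRN (p : {poly R}) :
  leb.-integrable (`]0%R, +oo[ : set R) (fun x => (p.[x] * expR (- x))%:E).
Proof.
rewrite horner_expRN_sum.
apply: integrable_sum => // i _; apply: integrableZl => //; exact: integrable_Xn_expRN.
Qed.

Lemma integral_horner_expRN (p : {poly R}) :
  (\int[leb]_(x in `]0%R, +oo[) (p.[x] * expR (- x))%:E = (lapl p)%:E)%E.
Proof.
rewrite horner_expRN_sum.
rewrite integral_sum//; last first.
  move=> i; apply: integrableZl => //; exact: integrable_Xn_expRN.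
rewrite /lapl -sumEFin; apply: eq_bigr => i _.
by rewrite integralZl ?integral_Xn_expRN//; exact: integrable_Xn_expRN.
Qed.

Lemma Gamma_nat n : Gamma (n%:R + 1) = n`!%:R :> R.
Proof.
rewrite /Gamma addrK.
rewrite (_ : n`!%:R = fine (n`!%:R%:E : \bar R))// -integral_Xn_expRN; congr fine.
apply: eq_integral => x; rewrite inE/= in_itv/= andbT => x0.
by rewrite powR_mulrn// ltW.
Qed.
End HalfLine.

(** * Gamma at half-integers from the Gaussian integral *)

Section Gauss.
Variable R : realType.
Local Notation leb := (@lebesgue_measure R).

(** Gamma(n+3/2) and K_{l+1/2} both reduce to this primitive, through s = sqrt t and s = sqrt(2z)
    sinh(t/2). *)
Lemma gauss_primitive : exists G : R -> R,
  [/\ forall s : R, 0 < s -> is_derive s 1 G (expR (- s ^+ 2)),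
      G 0 = 0, G x @[x --> 0^'+] --> (0 : R) &
      G x @[x --> +oo] --> Num.sqrt (pi : R) / 2].
Proof.
pose G := fun x : R => gauss_integral_proof.integral0_gauss x.
have cg : continuous (@gauss_fun R) by exact: continuous_gauss_fun.
have ig x : leb.-integrable `[0%R, x] (EFin \o (@gauss_fun R)).
  apply: continuous_compact_integrable => //; first exact: segment_compact.
  exact: continuous_subspaceT.
have G0 : G 0 = 0.
  by rewrite /G /gauss_integral_proof.integral0_gauss set_itv1 Rintegral_set1.
exists G; split=> //.
- move=> s s0; have [] := @continuous_FTC1_closed R (@gauss_fun R) 0 s (s + 1).
  + by rewrite ltrDl.
  + exact: ig.
  + by [].
  + exact: cg.
  move=> dG eG; split; first exact: dG.
  by rewrite -derive1E eG.
- have := @parameterized_integral_continuous R 0 1 (@gauss_fun R) ler01 (ig 1).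
  move/(continuous_within_itvP _ ltr01) => -[_ + _].
  by rewrite -[X in _ --> X]/(G 0) G0.
- have : Num.sqrt (gauss_integral_proof.integral0_gauss x ^+ 2) @[x --> +oo]
      --> Num.sqrt (pi / 4 : R).
    apply: continuous_cvg => //;
      [exact: sqrt_continuous|exact: gauss_integral_proof.cvg_integral0_gauss_sqr].
  rewrite sqrtrM ?pi_ge0// sqrtrV// (_ : 4 = 2 ^+ 2); last first.
    by rewrite expr2 -natrM.
  rewrite sqrtr_sqr ger0_norm//.
  rewrite (_ : (fun _ => Num.sqrt _) = G)//.
  apply/funext => r; rewrite sqrtr_sqr// ger0_norm//.
  exact: gauss_integral_proof.integral0_gauss_ge0.
Qed.

Lemma cvg_at_right0_comp (h : R -> R) : {for 0, continuous h} -> h 0 = 0 ->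
  (forall t, 0 < t -> 0 < h t) -> h t @[t --> 0^'+] --> (0 : R)^'+.
Proof.
move=> ch h0 hp A; rewrite /at_right/= => -[e e0 eA].
have : h t @[t --> (0:R)] --> h 0 by exact: ch.
rewrite h0 => /cvgrPdist_lt/(_ e e0) [d d0 dh].
exists d => // t td t0; apply: eA; last exact: hp.
by have := dh t td; rewrite /ball_/=.
Qed.

(* Gamma(n + 3/2) *)
Fixpoint gamma_half n : R := if n is m.+1 then (m%:R + 3 / 2) * gamma_half m else Num.sqrt pi / 2.

Lemma gamma_half_gt0 n : 0 < gamma_half n.
Proof.
elim: n => [|n IH] /=; first by rewrite divr_gt0 ?sqrtr_gt0 ?pi_gt0.
by rewrite mulr_gt0// ltr_wpDl// divr_gt0.
Qed.

Lemma cvg_Xn_sqrt_expRN n : x ^+ n * Num.sqrt x * expR (- x) @[x --> +oo] --> (0 : R).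
Proof.
apply: (@squeeze_cvgr _ _ _ _ (fun=> 0) (fun x => x ^+ n.+1 * expR (- x))).
- near=> x.
  have x1 : 1 < x by near: x; apply: nbhs_pinfty_gt; exact: num_real.
  have x0 : 0 < x by exact: lt_trans x1.
  rewrite !mulr_ge0 ?expR_ge0 ?exprn_ge0 ?sqrtr_ge0 ?(ltW x0)//=.
  rewrite ler_wpM2r ?expR_ge0// exprSr ler_wpM2l ?exprn_ge0 ?(ltW x0)//.
  rewrite -[leRHS]ger0_norm ?(ltW x0)// -sqrtr_sqr ler_sqrt ?sqr_ge0//.
  by rewrite expr2 ler_peMl ?ltW.
- exact: cvg_cst.
- exact: cvg_exprn_expRN.
Unshelve. all: by end_near. Qed.

Lemma continuous_Xn_sqrt_expRN n : continuous (fun x : R => x ^+ n * Num.sqrt x * expR (- x)).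
Proof.
move=> x; apply: cvgM; last exact: (der_cvg (der_expR (derN (der_id x)))).
apply: cvgM; last exact: sqrt_continuous.
exact: exprn_continuous.
Qed.

(** The induction carries a primitive of t^(n+1/2) e^(-t) together with its limits, so the recursion
    of Gamma is integration by parts on primitives. *)
Lemma Gamma_half n : Gamma (n%:R + 3 / 2) = gamma_half n.
Proof.
have [G [dG G0 rG lG]] := gauss_primitive.
have [F [dF F0 rF lF]] : exists F : R -> R,
  [/\ forall s : R, 0 < s -> is_derive s 1 F (s ^+ n * Num.sqrt s * expR (- s)),
      F 0 = 0, F x @[x --> 0^'+] --> (0 : R) &
      F x @[x --> +oo] --> gamma_half n].
  elim: n => [|n [F [dF F0 rF lF]]].
    (* Substitution s = sqrt t in the Gaussian, then one integration by parts. *)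
    exists (fun t => G (Num.sqrt t) - t ^+ 0 * Num.sqrt t * expR (- t)); split.
    - move=> s s0.
      have s0' : 0 < Num.sqrt s by rewrite sqrtr_gt0.
      refine (der_eq (derB (der_comp (is_derive1_sqrt s0) (dG _ s0'))
        (derM (derM (derX 0 (der_id s)) (is_derive1_sqrt s0)) (der_expR (derN (der_id s))))) _).
      by rewrite sqr_sqrtr ?ltW// expr0; field; rewrite gt_eqF.
    - by rewrite sqrtr0 G0 mulr0 mul0r subrr.
    - have h1 : G (Num.sqrt t) @[t --> 0^'+] --> (0 : R).
        apply: (cvg_comp Num.sqrt G _ rG).
        apply: cvg_at_right0_comp; [exact: sqrt_continuous|exact: sqrtr0|].
        by move=> t; rewrite sqrtr_gt0.
      have h2 : x ^+ 0 * Num.sqrt x * expR (- x) @[x --> 0^'+] --> (0 : R).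
        have := @continuous_Xn_sqrt_expRN 0 0; rewrite /continuous_at sqrtr0 mulr0 mul0r.
        by move/cvg_at_right_filter.
      by have := cvgB h1 h2; rewrite subr0; apply.
    - have h1 : G (Num.sqrt t) @[t --> +oo] --> Num.sqrt (pi : R) / 2.
        apply: (cvg_comp Num.sqrt G _ lG).
        apply/cvgryPge => A; near=> t.
        have t0 : 0 <= t by near: t; apply: nbhs_pinfty_ge; exact: num_real.
        have tA : A ^+ 2 <= t by near: t; apply: nbhs_pinfty_ge; exact: num_real.
        by apply: le_trans (ler_norm A) _; rewrite -sqrtr_sqr ler_sqrt.
      by have := cvgB h1 (@cvg_Xn_sqrt_expRN 0); rewrite subr0; apply.
  exists (fun t => (n%:R + 3 / 2) * F t - t ^+ n.+1 * Num.sqrt t * expR (- t)); split.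
  - move=> s s0.
    refine (der_eq (derB (derM (der_cst _ s) (dF _ s0))
      (derM (derM (derX n.+1 (der_id s)) (is_derive1_sqrt s0)) (der_expR (derN (der_id s))))) _).
    have r0 : Num.sqrt s != 0 by rewrite gt_eqF// sqrtr_gt0.
    rewrite /= exprS -natr1.
    have -> : s * s ^+ n * (2 * Num.sqrt s)^-1 = s ^+ n * Num.sqrt s / 2.
      by rewrite -{1}(sqr_sqrtr (ltW s0)); field.
    by field.
  - by rewrite F0 sqrtr0 !mulr0 mul0r subrr.
  - have h2 : x ^+ n.+1 * Num.sqrt x * expR (- x) @[x --> 0^'+] --> (0 : R).
      have := @continuous_Xn_sqrt_expRN n.+1 0; rewrite /continuous_at sqrtr0 mulr0 mul0r.
      by move/cvg_at_right_filter.
    by have := cvgB (@cvgMl_tmp _ _ _ _ _ (n%:R + 3 / 2) _ rF) h2; rewrite mulr0 subr0; apply.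
  - by have := cvgB (@cvgMl_tmp _ _ _ _ _ (n%:R + 3 / 2) _ lF) (@cvg_Xn_sqrt_expRN n.+1);
    rewrite subr0; apply.
have E : (\int[leb]_(x in `]0%R, +oo[) (x ^+ n * Num.sqrt x * expR (- x))%:E = (gamma_half n)%:E)%E.
  have := @integral_oy_FTC R (fun x => x ^+ n * Num.sqrt x * expR (- x)) F (gamma_half n).
  rewrite F0 subr0; apply => //.
  - by move=> x x0; rewrite !mulr_ge0 ?exprn_ge0 ?expR_ge0 ?sqrtr_ge0.
  - apply: continuous_subspaceT; exact: continuous_Xn_sqrt_expRN.
rewrite /Gamma (_ : gamma_half n = fine (gamma_half n)%:E)// -E; congr fine.
apply: eq_integral => x; rewrite inE/= in_itv/= andbT => x0.
congr (_ * _)%:E; rewrite -powR12_sqrt ?ltW// -powR_mulrn ?ltW// -powRD;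
  last by rewrite (gt_eqF x0) implybT.
by congr (_ `^ _); field.
Unshelve. all: by end_near. Qed.

End Gauss.

Section BesselPolynomialRec.
Variable R : numFieldType.

Lemma coef_bessel_poly l n : (bessel_poly R l)`_n = if (n <= l)%N then bessel_coef R l n else 0.
Proof.
have -> : bessel_poly R l = \poly_(i < l.+1) bessel_coef R l i by rewrite poly_def.
by rewrite coef_poly ltnS.
Qed.

(** The form that K_{nu+1} = K_{nu-1} + (2 nu/z) K_nu takes at nu = l+3/2 once the elementary
    factors are removed. Truncated subtraction in the factorials forces the case split. *)
Lemma bessel_poly_rec l : bessel_poly R l.+2 = 'X^2 * bessel_poly R l +
  (2 * (2 * l + 3))%:R *: bessel_poly R l.+1.
Proof.
have f0 m : m`!%:R != 0 :> R by rewrite pnatr_eq0 -lt0n fact_gt0.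
have f1 m : m.+1%:R != 0 :> R by rewrite pnatr_eq0.
have f2 k m : k.+1%:R + m%:R != 0 :> R by rewrite -natrD f1.
apply/polyP => -[|[|n]]; rewrite coefD coefZ coefXnM /= !coef_bessel_poly.
- rewrite add0r /bessel_coef !subn0 /=.
  have -> : (2 * l.+2 = (2 * l.+1).+2)%N by lia.
  rewrite !factS !natrM; field.
  by rewrite ?f0 ?nat1r ?f2 ?f1.
- rewrite add0r /bessel_coef !ltnS !leq0n.
  have -> : (l.+2 - 1 = l.+1)%N by lia.
  have -> : (l.+1 - 1 = l)%N by lia.
  have -> : (2 * l.+2 - 1 = (2 * l + 1).+2)%N by lia.
  have -> : (2 * l.+1 - 1 = (2 * l + 1))%N by lia.
  rewrite !factS !natrM; field.
  by rewrite ?f0 ?nat1r ?f2 ?f1.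
rewrite !subSS subn0 !ltnS.
have [nl|nl|<-] := ltngtP n l; last 2 first.
- by rewrite mulr0 addr0.
- rewrite mulr0 addr0 /bessel_coef !subnn.
  have -> : (2 * n.+2 - n.+2 = n.+2)%N by lia.
  have -> : (2 * n - n = n)%N by lia.
  by rewrite !mulr1 !divff.
have [->|ml] := eqVneq l n.+1.
  rewrite /bessel_coef !subnn.
  have -> : (n.+3 - n.+2 = 1)%N by lia.
  have -> : (2 * n.+3 - n.+2 = n.+2.+2)%N by lia.
  have -> : (2 * n.+1 - n = n.+2)%N by lia.
  have -> : (2 * n.+2 - n.+2 = n.+2)%N by lia.
  have -> : (n.+1 - n = 1)%N by lia.
  rewrite !factS !natrM; field.
  by rewrite ?f0 ?nat1r ?f2 ?f1.
have [m lE] : exists m, l = (n + m).+2 by exists (l - n.+2)%N; move/eqP: ml; lia.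
rewrite /bessel_coef lE.
have -> : (2 * (n + m).+4 - n.+2 = (n + 2 * m + 2).+4)%N by lia.
have -> : (2 * (n + m).+2 - n = (n + 2 * m + 2).+2)%N by lia.
have -> : (2 * (n + m).+3 - n.+2 = (n + 2 * m + 2).+2)%N by lia.
have -> : ((n + m).+4 - n.+2 = m.+2)%N by lia.
have -> : ((n + m).+2 - n = m.+2)%N by lia.
have -> : ((n + m).+3 - n.+2 = m.+1)%N by lia.
rewrite !factS !natrM; field.
by rewrite ?f0 ?nat1r ?f2 ?f1.
Qed.

Lemma bessel_poly0 : bessel_poly R 0 = 1.
Proof.
by rewrite /bessel_poly big_ord1 /bessel_coef subnn fact0 mulr1 divr1 expr0 scale1r.
Qed.
Lemma bessel_poly1 : bessel_poly R 1 = 2%:P + 'X.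
Proof.
rewrite /bessel_poly big_ord_recl big_ord1 /bessel_coef /= !fact0 !mulr1 divr1 expr0 alg_polyC.
by rewrite invr1 mulr1 expr1 scale1r.
Qed.
End BesselPolynomialRec.

(** * K at half-integers *)

Section BesselK.
Variable R : realType.
Local Notation leb := (@lebesgue_measure R).

Definition sinhR (t : R) : R := (expR t - expR (- t)) / 2.

Lemma der_sinhR (f : R -> R) (x a : R) : is_derive x 1 f a ->
  is_derive x 1 (fun t => sinhR (f t)) (coshR (f x) * a).
Proof.
move=> h; refine (der_eq (derM (derB (der_expR h) (der_expR (derN h))) (der_cst 2^-1 x)) _).
rewrite /coshR; ring.
Qed.
Lemma der_coshR (f : R -> R) (x a : R) : is_derive x 1 f a ->
  is_derive x 1 (fun t => coshR (f t)) (sinhR (f x) * a).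
Proof.
move=> h; refine (der_eq (derM (derD (der_expR h) (der_expR (derN h))) (der_cst 2^-1 x)) _).
rewrite /sinhR; ring.
Qed.

Lemma coshR_ge (t : R) : expR t / 2 <= coshR t.
Proof. by rewrite /coshR ler_pM2r// lerDl expR_ge0. Qed.
Lemma coshR_ge0 (t : R) : 0 <= coshR t.
Proof. by rewrite (le_trans _ (coshR_ge t))// divr_ge0 ?expR_ge0. Qed.
Lemma sinhR_ge0 (t : R) : 0 <= t -> 0 <= sinhR t.
Proof. by move=> t0; rewrite /sinhR divr_ge0// subr_ge0 ler_expR; lra. Qed.
Lemma sinhR_gt0 (t : R) : 0 < t -> 0 < sinhR t.
Proof. by move=> t0; rewrite /sinhR divr_gt0// subr_gt0 ltr_expR; lra. Qed.
Lemma sinhR_le (t : R) : sinhR t <= expR t.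
Proof.
by rewrite /sinhR ler_pdivrMr//; have := expR_ge0 (- t); have := expR_ge0 t; lra.
Qed.
Lemma sinhR_sinhR (s t : R) : sinhR s * sinhR t = (coshR (t + s) - coshR (t - s)) / 2.
Proof. by rewrite /sinhR /coshR !opprD opprK !expRD; field. Qed.
Lemma coshRE (t : R) : coshR t = 1 + 2 * sinhR (t / 2) ^+ 2.
Proof.
rewrite /coshR /sinhR {1 2}(_ : t = t / 2 + t / 2); last by field.
rewrite opprD !expRD.
have := expRxMexpNx_1 (t / 2); set u := expR _; set v := expR _ => uv.
by rewrite -[X in _ = X + _]uv; field.
Qed.
Lemma coshRN (t : R) : coshR (- t) = coshR t.
Proof. by rewrite /coshR opprK addrC. Qed.

Section FixedArgument.
Variables (z : R) (z0 : 0 < z).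
Let K nu t := expR (- (z * coshR t)) * coshR (nu * t).
Let S nu t := expR (- (z * coshR t)) * sinhR (nu * t).

(** Integrated over t > 0, this is the recurrence of K in its order; [S nu] supplies the correction
    between primitives. *)
Lemma der_S (nu t : R) : is_derive t 1 (S nu) (nu * K nu t - z / 2 * (K (nu + 1) t - K (nu - 1) t)).
Proof.
have hc := der_coshR (der_id t).
have hs := der_sinhR (derM (der_cst nu t) (der_id t)).
refine (der_eq (derM (der_expR (derN (derM (der_cst z t) hc))) hs) _).
have E := sinhR_sinhR t (nu * t).
rewrite /K !mulrDl mulN1r mul1r.
transitivity (nu * (expR (- (z * coshR t)) * coshR (nu * t)) - z *
  (expR (- (z * coshR t)) * (sinhR t * sinhR (nu * t)))); first by ring.
by rewrite E; field.
Qed.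

Lemma continuous_K (nu : R) : continuous (K nu).
Proof.
move=> t.
have hc := der_coshR (der_id t).
have hs := der_coshR (derM (der_cst nu t) (der_id t)).
exact: (der_cvg (derM (der_expR (derN (derM (der_cst z t) hc))) hs)).
Qed.

(** With u = (z/2) e^t, the function is at most a constant times u^n e^(-u) for an integer n >=
    nu. *)
Lemma cvg_S (nu : R) : 0 <= nu -> S nu t @[t --> +oo] --> (0 : R).
Proof.
move=> nu0; pose n := (Num.trunc nu).+1.
have nun : nu <= n%:R by rewrite ltW// truncnS_gt.
have h : ((2 / z) ^+ n * ((z / 2 * expR t) ^+ n * expR (- (z / 2 * expR t)))) @[t --> +oo] -->
  (0 : R).
  rewrite -[X in _ --> X](mulr0 ((2 / z) ^+ n)); apply: cvgMl_tmp.
  apply: (cvg_comp (fun t => z / 2 * expR t) (fun u => u ^+ n * expR (- u)) _ (cvg_exprn_expRN n)).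
  apply/cvgryPge => A; near=> t.
  have t1 : A * (2 / z) <= t by near: t; apply: nbhs_pinfty_ge; exact: num_real.
  rewrite mulrC -ler_pdivrMr ?divr_gt0//.
  apply: le_trans (le_trans t1 _) ; first by rewrite invf_div.
  by rewrite (le_trans _ (expR_ge1Dx t))// lerDr.
apply: (@squeeze_cvgr _ _ _ _ (fun=> 0) _ _ _ _ _ h); last exact: cvg_cst.
near=> t.
have t0 : 0 <= t by near: t; apply: nbhs_pinfty_ge; exact: num_real.
rewrite mulr_ge0 ?expR_ge0 ?sinhR_ge0 ?mulr_ge0//=.
rewrite mulrA -exprMn (_ : 2 / z * (z / 2 * expR t) = expR t); last by field; rewrite gt_eqF.
rewrite [leRHS]mulrC /S ler_pM ?expR_ge0 ?sinhR_ge0 ?mulr_ge0//; last first.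
  by rewrite -expRM_natl (le_trans (sinhR_le _))// ler_expR ler_wpM2r.
rewrite ler_expR lerN2 (_ : z / 2 * expR t = z * (expR t / 2)); last by field.
by rewrite ler_wpM2l ?(ltW z0)// coshR_ge.
Unshelve. all: by end_near. Qed.

Definition half_besselK l : R :=
  Num.sqrt pi / Num.sqrt (2 * z) * expR (- z) * ((2 * z) ^- l * (bessel_poly R l).[2 * z]).

Lemma half_besselK_rec l : half_besselK l.+2 =
  half_besselK l + (2 * l%:R + 3) / z * half_besselK l.+1.
Proof.
rewrite /half_besselK bessel_poly_rec hornerD hornerZ hornerM hornerXn natrM natrD natrM !exprS.
field.
by rewrite expf_neq0 ?gt_eqF ?sqrtr_gt0 ?mulr_gt0.
Qed.

(** The recurrence acts on primitives, whose limits at 0 and infinity are followed. Order 1/2 is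
    Gaussian, since cosh t = 1 + 2 sinh^2(t/2) and cosh(t/2) dt = 2 d sinh(t/2). *)
Lemma K_primitive l : exists F : R -> R,
  [/\ forall t : R, 0 < t -> is_derive t 1 F (K (l%:R + 1 / 2) t),
      F 0 = 0, F x @[x --> 0^'+] --> (0 : R) &
      F x @[x --> +oo] --> half_besselK l].
Proof.
have S0 nu : S nu 0 = 0 by rewrite /S /sinhR mulr0 oppr0 subrr mul0r mulr0.
have Sr nu : S nu x @[x --> 0^'+] --> (0 : R).
  by rewrite -[X in _ --> X](S0 nu); apply: cvg_at_right_filter; exact: (der_cvg (der_S nu 0)).
have [F0 [dF0 F00 rF0 lF0]] : exists F : R -> R,
  [/\ forall t : R, 0 < t -> is_derive t 1 F (K (1 / 2) t),
      F 0 = 0, F x @[x --> 0^'+] --> (0 : R) &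
      F x @[x --> +oo] --> half_besselK 0].
  have [G [dG G0 rG lG]] := gauss_primitive R.
  have c0 : 0 < Num.sqrt (2 * z) by rewrite sqrtr_gt0 mulr_gt0.
  pose h (t : R) : R := Num.sqrt (2 * z) * sinhR (t / 2).
  have dh (t : R) : is_derive t 1 h (Num.sqrt (2 * z) * coshR (t / 2) / 2).
    refine (der_eq (derM (der_cst _ t) (der_sinhR (derM (der_id t) (der_cst 2^-1 t)))) _); ring.
  exists (fun t => 2 * expR (- z) / Num.sqrt (2 * z) * G (h t)); split.
  - move=> t t0.
    have ht : 0 < h t by rewrite mulr_gt0// sinhR_gt0// divr_gt0.
    refine (der_eq (derM (der_cst _ t) (der_comp (dh t) (dG _ ht))) _).
    rewrite /K (coshRE t) /h exprMn sqr_sqrtr ?mulr_ge0 ?(ltW z0)//.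
    set sh := sinhR _.
    have -> : - (z * (1 + 2 * sh ^+ 2)) = - z + - (2 * z * sh ^+ 2) by ring.
    rewrite expRD (_ : 1 / 2 * t = t / 2); last by field.
    by field; rewrite gt_eqF.
  - by rewrite /h mul0r /sinhR oppr0 subrr mul0r mulr0 G0 mulr0.
  - have Gh : G (h t) @[t --> 0^'+] --> (0 : R).
      apply: (cvg_comp h G _ rG); apply: cvg_at_right0_comp.
      + exact: (der_cvg (dh 0)).
      + by rewrite /h mul0r /sinhR oppr0 subrr mul0r mulr0.
      + by move=> t t0; rewrite mulr_gt0// sinhR_gt0// divr_gt0.
    by have := @cvgMl_tmp _ _ _ _ _ (2 * expR (- z) / Num.sqrt (2 * z)) _ Gh; rewrite mulr0; apply.
  - have -> : half_besselK 0 = 2 * expR (- z) / Num.sqrt (2 * z) * (Num.sqrt (pi : R) / 2).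
      by rewrite /half_besselK bessel_poly0 hornerC expr0 invr1; field; rewrite gt_eqF.
    apply: cvgMl_tmp; apply: (cvg_comp h G _ lG).
    apply/cvgryPge => A; near=> t.
    have t1 : A / Num.sqrt (2 * z) * 2 <= t / 2.
      rewrite ler_pdivlMr//; near: t; apply: nbhs_pinfty_ge; exact: num_real.
    have t0 : 0 <= t by near: t; apply: nbhs_pinfty_ge; exact: num_real.
    rewrite /h mulrC -ler_pdivrMr//.
    rewrite /sinhR ler_pdivlMr// (le_trans t1)//.
    have h1 := expR_ge1Dx (t / 2).
    have h2 : expR (- (t / 2)) <= 1 by rewrite expR_le1 oppr_le0 divr_ge0.
    by move: h1 h2; lra.
elim/ltn_ind: l => -[|[|l]] IH.
- by exists F0; rewrite add0r.
- exists (fun t => (1 + z^-1) * F0 t - 2 / z * S (1 / 2) t); split.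
  + move=> t t0.
    refine (der_eq (derB (derM (der_cst _ t) (dF0 _ t0))
      (derM (der_cst (2 / z) t) (der_S (1 / 2) t))) _).
    (* The integrand is even in the order, so order 3/2 needs order 1/2 alone. *)
    have -> : K (1 / 2 - 1) t = K (1 / 2) t.
      by rewrite /K; congr (_ * _); rewrite -[LHS]coshRN; congr coshR; field.
    rewrite [X in _ = K X t](_ : _ = 1 / 2 + 1); last by rewrite addrC.
    by field; rewrite gt_eqF.
  + by rewrite F00 S0 !mulr0 subrr.
  + by have := cvgB (@cvgMl_tmp _ _ _ _ _ (1 + z^-1) _ rF0)
    (@cvgMl_tmp _ _ _ _ _ (2 / z) _ (Sr (1 / 2))); rewrite !mulr0 subrr; apply.
  + have nu0 : 0 <= 1 / 2 :> R by [].
    have -> : half_besselK 1 = (1 + z^-1) * half_besselK 0.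
      rewrite /half_besselK bessel_poly0 bessel_poly1 hornerD hornerX !hornerC expr0 invr1 expr1.
      by field; rewrite ?gt_eqF ?sqrtr_gt0 ?mulr_gt0.
    by have := cvgB (@cvgMl_tmp _ _ _ _ _ (1 + z^-1) _ lF0)
      (@cvgMl_tmp _ _ _ _ _ (2 / z) _ (cvg_S nu0)); rewrite !mulr0 subr0; apply.
have [F [dF F1 rF lF]] := IH l (ltnW (ltnSn _)).
have [F' [dF' F1' rF' lF']] := IH l.+1 (ltnSn _).
pose nu := l.+1%:R + 1 / 2 : R.
have nu0 : 0 <= nu by rewrite addr_ge0.
exists (fun t => F t + (2 * l%:R + 3) / z * F' t - 2 / z * S nu t); split.
- move=> t t0.
  refine (der_eq (derB (derD (dF _ t0) (derM (der_cst _ t) (dF' _ t0)))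
    (derM (der_cst (2 / z) t) (der_S nu t))) _).
  have -> : nu - 1 = l%:R + 1 / 2 by rewrite /nu -natr1; ring.
  have -> : l.+2%:R + 1 / 2 = nu + 1 by rewrite /nu -[l.+2%:R]natr1; ring.
  rewrite -/nu {1 2}/nu; field; by rewrite gt_eqF.
- by rewrite F1 F1' S0 !mulr0 addr0 subrr.
- by have := cvgB (cvgD rF (@cvgMl_tmp _ _ _ _ _ ((2 * l%:R + 3) / z) _ rF'))
  (@cvgMl_tmp _ _ _ _ _ (2 / z) _ (Sr nu)); rewrite !mulr0 addr0 subrr; apply.
- rewrite half_besselK_rec.
  by have := cvgB (cvgD lF (@cvgMl_tmp _ _ _ _ _ ((2 * l%:R + 3) / z) _ lF'))
    (@cvgMl_tmp _ _ _ _ _ (2 / z) _ (cvg_S nu0)); rewrite mulr0 subr0; apply.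
Unshelve. all: by end_near. Qed.

Lemma BesselK_half l : BesselK (l%:R + 1 / 2) z = half_besselK l.
Proof.
have [F [dF F0 rF lF]] := K_primitive l.
rewrite /BesselK (_ : half_besselK l = fine (half_besselK l)%:E)//; congr fine.
have := @integral_cy_FTC R (K (l%:R + 1 / 2)) F (half_besselK l).
rewrite F0 subr0; apply => //.
- by move=> x x0; rewrite mulr_ge0 ?expR_ge0 ?coshR_ge0.
- apply: continuous_subspaceT; exact: continuous_K.
Qed.
End FixedArgument.
End BesselK.

(** * Closed form of M_j *)

Section PowerSeries.
Variable R : realType.

(** This bound makes the series entire and survives formal differentiation, so termwise derivatives
    of all orders are available. *)
Definition fact_bounded (c : nat -> R) := exists C : R, forall n, `|c n| <= C / n`!%:R.

Lemma fact_bounded_diffs c : fact_bounded c -> fact_bounded (pseries_diffs c).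
Proof.
move=> [C h]; exists C => n; rewrite /pseries_diffs normrM normr_nat.
apply: le_trans (ler_wpM2l _ (h n.+1)) _; first by [].
rewrite factS natrM invfM mulrCA (mulrA n.+1%:R) divff ?pnatr_eq0// mul1r//.
Qed.

Lemma cvg_pseries_fact_bounded c x : fact_bounded c -> cvgn (pseries c x).
Proof.
move=> [C h]; apply: normed_cvg.
have C0 : 0 <= C by have := h 0; rewrite fact0 divr1; apply: le_trans.
apply: (@series_le_cvg _ _ (fun n => C * exp_coeff `|x| n)).
- move=> n; exact: normr_ge0.
- by move=> n; rewrite mulr_ge0// exp_coeff_ge0.
- move=> n; rewrite /exp_coeff/= normrM normrX.
  rewrite mulrCA mulrC ler_wpM2l ?exprn_ge0//.
- have -> : series (fun n => C * exp_coeff `|x| n) = (fun n => C * series (exp_coeff `|x|) n).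
    by apply/funext => n; rewrite /series/= mulr_sumr.
  apply: is_cvgMl_tmp; exact: is_cvg_series_exp_coeff.
Qed.

Definition pseries_sum c (x : R) : R := limn (pseries c x).

Lemma der_pseries_sum c (x : R) : fact_bounded c ->
  is_derive x 1 (pseries_sum c) (pseries_sum (pseries_diffs c) x).
Proof.
move=> h; apply: (@pseries_snd_diffs _ _ (`|x| + 1)).
- exact: cvg_pseries_fact_bounded.
- exact/cvg_pseries_fact_bounded/fact_bounded_diffs.
- by do 2! [apply: fact_bounded_diffs || apply: cvg_pseries_fact_bounded];
  exact: fact_bounded_diffs.
- by rewrite (lt_le_trans _ (ler_norm _))// ltrDl.
Qed.

Lemma pseries_sum0 c : pseries_sum c 0 = c 0%N.
Proof.
rewrite /pseries_sum; apply/cvg_lim => //; rewrite -(cvg_shiftn 1)/=.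
rewrite (_ : (fun _ => _) = (fun=> c 0%N)); first exact: cvg_cst.
apply/funext => n; rewrite /pseries /series /= addn1 big_nat_recl// expr0 mulr1.
by rewrite big1 ?addr0// => i _; rewrite expr0n mulr0.
Qed.

Lemma iter_diffs c q n : iter q (@pseries_diffs R) c n = (n + q)`!%:R / n`!%:R * c (n + q)%N.
Proof.
elim: q n => [|q IH] n; first by rewrite addn0 divff ?mul1r// pnatr_eq0 -lt0n fact_gt0.
rewrite iterS /pseries_diffs IH addSnnS (factS n) natrM invfM.
by field; rewrite nat1r !pnatr_eq0 -lt0n fact_gt0.
Qed.

End PowerSeries.

(** * Kummer's second formula on coefficients *)

Section CauchyConvolution.
Variable R : numFieldType.
Definition cauchy_conv (u v : nat -> R) k := \sum_(i < k.+1) u i * v (k - i)%N.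
(** Multiplication of the power series by its variable. *)
Definition shift_seq (u : nat -> R) k := if k is m.+1 then u m else 0.

Lemma cauchy_conv_index u v k : k%:R * cauchy_conv u v k =
  cauchy_conv (fun i => i%:R * u i) v k + cauchy_conv u (fun i => i%:R * v i) k.
Proof.
rewrite /cauchy_conv mulr_sumr -big_split; apply: eq_bigr => i _ /=.
by rewrite natrB ?(leq_ord i)//; ring.
Qed.

Lemma cauchy_conv_shiftl u v k : cauchy_conv (shift_seq u) v k = shift_seq (cauchy_conv u v) k.
Proof.
case: k => [|k]; rewrite /cauchy_conv; first by rewrite big_ord1 mul0r.
by rewrite big_ord_recl mul0r add0r; apply: eq_bigr => i _; rewrite lift0 subSS.
Qed.

Lemma cauchy_conv_shiftr u v k : cauchy_conv u (shift_seq v) k = shift_seq (cauchy_conv u v) k.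
Proof.
case: k => [|k]; rewrite /cauchy_conv; first by rewrite big_ord1 mulr0.
rewrite big_ord_recr/= subnn mulr0 addr0; apply: eq_bigr => i _.
by rewrite subSn// -ltnS.
Qed.

Lemma cauchy_convZl c u v k : cauchy_conv (fun i => c * u i) v k = c * cauchy_conv u v k.
Proof. by rewrite /cauchy_conv mulr_sumr; apply: eq_bigr => i _; rewrite mulrA. Qed.
Lemma cauchy_convZr c u v k : cauchy_conv u (fun i => c * v i) k = c * cauchy_conv u v k.
Proof. by rewrite /cauchy_conv mulr_sumr; apply: eq_bigr => i _; rewrite mulrCA. Qed.
Lemma cauchy_convDr u v w k : cauchy_conv u (fun i => v i + w i) k = cauchy_conv u v k +
  cauchy_conv u w k.
Proof. by rewrite /cauchy_conv -big_split; apply: eq_bigr => i _; rewrite mulrDr. Qed.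
Lemma eq_cauchy_convl u u' v k : u =1 u' -> cauchy_conv u v k = cauchy_conv u' v k.
Proof. by move=> h; apply: eq_bigr => i _; rewrite h. Qed.
Lemma eq_cauchy_convr u v v' k : v =1 v' -> cauchy_conv u v k = cauchy_conv u v' k.
Proof. by move=> h; apply: eq_bigr => i _; rewrite h. Qed.

Variables (b : nat) (v : nat -> R).
Hypothesis v1 : v 1%N = 0.
Hypothesis vS : forall n, n.+2%:R * (n.+2%:R + 2 * b%:R + 1) * v n.+2 = 4^-1 * v n.

(* Kummer's second formula: both sides satisfy the same first-order recursion. *)
Lemma kummer_second k : cauchy_conv (@half_exp_coef R) v k = kummer_coef R b k * v 0%N.
Proof.
(* [h] and [g] are the coefficients of e^(-z/2) v(z) and e^(-z/2) theta v(z). *)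
pose h := cauchy_conv (@half_exp_coef R) v.
pose g := cauchy_conv (@half_exp_coef R) (fun i => i%:R * v i).
have th n u : cauchy_conv (fun i => i%:R * half_exp_coef R i) u n = - 2^-1 *
  shift_seq (cauchy_conv (@half_exp_coef R) u) n.
  rewrite -cauchy_conv_shiftl -cauchy_convZl; apply: eq_cauchy_convl => -[|i].
    by rewrite mul0r mulr0.
  exact: half_exp_coefS.
have E1 n : n%:R * h n = - 2^-1 * shift_seq h n + g n by rewrite /h cauchy_conv_index th.
have E2 n : n%:R * g n = - 2^-1 * shift_seq g n +
  cauchy_conv (@half_exp_coef R) (fun i => i%:R * (i%:R * v i)) n.
  by rewrite /g cauchy_conv_index th.
have E3 n : cauchy_conv (@half_exp_coef R) (fun i => i%:R * (i%:R * v i)) n + (2 * b%:R + 1) * g n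
   = 4^-1 * shift_seq (shift_seq h) n.
  rewrite /g -cauchy_convZr -cauchy_convDr.
  have -> : shift_seq (shift_seq h) n = cauchy_conv (@half_exp_coef R) (shift_seq (shift_seq v)) n.
    rewrite cauchy_conv_shiftr; case: n => //= n; by rewrite cauchy_conv_shiftr.
  rewrite -cauchy_convZr; apply: eq_cauchy_convr => -[|[|i]] /=.
  - by rewrite !mul0r !mulr0 addr0.
  - by rewrite v1 !mulr0 addr0.
  - by rewrite -vS; ring.
have hS n : n.+1%:R * (2 * b.+1 + n)%:R * h n.+1 = - (b.+1 + n)%:R * h n.
  have /= e1 := E1 n.+1; have /= e2 := E2 n.+1; have /= e3 := E3 n.+1; have e0 := E1 n.
  have -> : n.+1%:R * (2 * b.+1 + n)%:R * h n.+1 =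
    (n.+1%:R + 2 * b%:R + 1) * (n.+1%:R * h n.+1) by rewrite natrD natrM; ring.
  rewrite e1.
  transitivity (- 2^-1 * (n.+1%:R + 2 * b%:R + 1) * h n +
    (n.+1%:R * g n.+1 + (2 * b%:R + 1) * g n.+1)).
    ring.
  rewrite e2.
  transitivity (- 2^-1 * (n.+1%:R + 2 * b%:R + 1) * h n - 2^-1 * g n + 4^-1 * shift_seq h n).
    by rewrite -e3; ring.
  (* The two terms of order n-1 cancel because (1/2)^2 = 1/4, which leaves a first-order
     recursion. *)
  have -> : g n = n%:R * h n + 2^-1 * shift_seq h n by rewrite e0; ring.
  by rewrite natrD; field.
elim: k => [|k IH].
  by rewrite /cauchy_conv big_ord1 /half_exp_coef expr0 fact0 divr1.
have d0 : k.+1%:R * (2 * b.+1 + k)%:R != 0 :> R by rewrite mulf_neq0 ?pnatr_eq0// mulnS.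
apply: (mulfI d0); rewrite [LHS]hS /h IH mulrA -(kummer_coefS R b k); ring.
Qed.
End CauchyConvolution.

(** * The Kummer function as an entire function *)

Section KummerFunction.
Variables (R : realType) (b : nat).

(** Coefficients of Itilde_{b+1/2}(z/2) in z: 16^m comes from (z/4)^(2m), and [gamma_half] at m+b is
    Gamma(m+b+3/2). Odd orders are filled with 0 so that Cauchy products apply. *)
Definition itilde_coef n : R :=
  if odd n then 0 else (16 ^+ n./2 * n./2`!%:R * gamma_half R (n./2 + b))^-1.

Lemma itilde_coef1 : itilde_coef 1 = 0. Proof. by []. Qed.

Lemma itilde_coef0 : itilde_coef 0 = (gamma_half R b)^-1.
Proof. by rewrite /itilde_coef /= expr0 fact0 !mul1r. Qed.

Lemma itilde_coefSS n : n.+2%:R * (n.+2%:R + 2 * b%:R + 1) * itilde_coef n.+2 = 4^-1 *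
  itilde_coef n.
Proof.
rewrite /itilde_coef /= negbK; case: ifPn => on; first by rewrite !mulr0.
have g0 : gamma_half R (n./2 + b) != 0 by rewrite gt_eqF// gamma_half_gt0.
have f0 : n./2`!%:R != 0 :> R by rewrite pnatr_eq0 -lt0n fact_gt0.
have e0 : 16 ^+ n./2 != 0 :> R by rewrite expf_neq0// pnatr_eq0.
have nE : n%:R = 2 * n./2%:R :> R.
  by rewrite -natrM -[in LHS](odd_double_half n) (negPf on) add0n -mul2n.
rewrite factS exprS -[n.+2]addn2 natrD nE natrM natrD.
move: (16 ^+ n./2) e0 => e e0; field.
have h0 : 0 <= n./2%:R :> R by []. have h1 : 0 <= b%:R :> R by [].
rewrite e0 f0 g0 /= nat1r pnatr_eq0 andbT gt_eqF//; lra.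
Qed.

Lemma itilde_coef_ge0 n : 0 <= itilde_coef n.
Proof.
rewrite /itilde_coef; case: ifP => // _; rewrite invr_ge0 !mulr_ge0// ltW// gamma_half_gt0//.
Qed.

(** In steps of two, n! times the coefficient changes by the ratio (n+1)/(4(n+2b+3)), which is at
    most 1. *)
Lemma itilde_coef_bounded : fact_bounded itilde_coef.
Proof.
exists (itilde_coef 0) => n; rewrite ger0_norm ?itilde_coef_ge0//.
rewrite ler_pdivlMr ?ltr0n ?fact_gt0//.
elim/ltn_ind: n => -[|[|n]] IH.
- by rewrite fact0 mulr1.
- by rewrite itilde_coef1 mul0r itilde_coef_ge0.
apply: le_trans (IH n _); last by rewrite ltnW.
have /= E := itilde_coefSS n.
have h1 : 0 <= b%:R :> R by []. have h2 : 0 <= n%:R :> R by [].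
have i0 := itilde_coef_ge0 n.
have n1 : n.+1%:R = n%:R + 1 :> R by rewrite natr1.
have n2 : n.+2%:R = n%:R + 2 :> R by rewrite -addn2 natrD.
have -> : itilde_coef n.+2 = 4^-1 * itilde_coef n / (n.+2%:R * (n.+2%:R + 2 * b%:R + 1)).
  by rewrite -E mulrC mulKf// mulf_neq0 ?pnatr_eq0// gt_eqF// n2; lra.
rewrite !factS !natrM.
have -> : 4^-1 * itilde_coef n / (n.+2%:R * (n.+2%:R + 2 * b%:R + 1)) *
  (n.+2%:R * (n.+1%:R * n`!%:R)) =
   (itilde_coef n * n`!%:R) * (4^-1 * n.+1%:R / (n.+2%:R + 2 * b%:R + 1)).
  rewrite n1 n2; field; by rewrite !gt_eqF//; lra.
have d0 : 0 < n%:R + 2 + 2 * b%:R + 1 :> R by lra.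
rewrite n1 n2 -[leRHS]mulr1; apply: ler_wpM2l; first exact: mulr_ge0.
by rewrite ler_pdivrMr//; lra.
Qed.

Definition itilde_derive q := pseries_sum (iter q (@pseries_diffs R) itilde_coef).

Lemma itilde_derive_bounded q : fact_bounded (iter q (@pseries_diffs R) itilde_coef).
Proof. by elim: q => [|q IH]; [exact: itilde_coef_bounded|exact: fact_bounded_diffs]. Qed.

Lemma der_itilde_derive q (z : R) : is_derive z 1 (itilde_derive q) (itilde_derive q.+1 z).
Proof. exact/der_pseries_sum/itilde_derive_bounded. Qed.

Lemma Itilde_pseries_sum (z : R) : Itilde ((2 * b + 1)%:R / 2) (z / 2) = pseries_sum itilde_coef z.
Proof.
have c := @cvg_pseries_fact_bounded R _ z itilde_coef_bounded.
have c2 : (fun n => (2 * n)%N) @ \oo --> \oo.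
  by apply/cvgnyPge => A; exists A => // n /=; lia.
rewrite /Itilde; set F := (X in limn X).
(* The defining partial sums are those of the full series at even lengths. *)
suff -> : F = pseries itilde_coef z \o muln 2 by apply/cvg_lim => //; exact: cvg_comp c2 c.
apply/funext => n; rewrite /F /= /pseries /series /=.
elim: n => [|n IH]; first by rewrite !big_nil.
rewrite mulnS add2n !big_nat_recr//= IH -addrA; congr (_ + _).
rewrite {2}/itilde_coef /= oddM/= mul0r addr0 /itilde_coef oddM/=.
have -> : (2 * n)./2 = n by rewrite mul2n doubleK.
rewrite -(Gamma_half R (n + b)).
have -> : n%:R + (2 * b + 1)%:R / 2 + 1 = (n + b)%:R + 3 / 2 :> R.
  by rewrite !(natrM, natrD); field.
set g := Gamma _.
rewrite !exprMn mulnC !exprM exprVn.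
have f0 : n`!%:R != 0 :> R by rewrite pnatr_eq0 -lt0n fact_gt0.
have -> : (16 : R) = 4 ^+ 2 by rewrite -natrX.
have -> : (4 : R) = 2 ^+ 2 by rewrite -natrX.
have -> : 2 ^+ 2 ^+ 2 ^+ n = (2 ^+ n) ^+ 2 * (2 ^+ n) ^+ 2 :> R.
  by rewrite -exprD -!exprM; congr (_ ^+ _); lia.
have e0 : 2 ^+ n != 0 :> R by rewrite expf_neq0.
have g0 : g != 0 by rewrite gt_eqF// /g Gamma_half gamma_half_gt0.
move: (2 ^+ n) e0 => e e0.
by field; rewrite e0 g0 f0.
Qed.

Lemma der_sum (n : nat) (f : nat -> R -> R) (d : nat -> R) (x : R) :
  (forall i, is_derive x 1 (f i) (d i)) ->
  is_derive x 1 (fun t => \sum_(i < n) f i t) (\sum_(i < n) d i).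
Proof.
move=> h; elim: n => [|n IH].
  under eq_fun do rewrite big_ord0; rewrite big_ord0; exact: der_cst.
under eq_fun do rewrite big_ord_recr /=; rewrite big_ord_recr /=; exact: derD.
Qed.

(* q-th derivative of e^(-z/2) Itilde_{b+1/2}(z/2) *)
Definition kummer_derive q (z : R) := expR (- (z / 2)) *
  \sum_(i < q.+1) 'C(q, i)%:R * (- 2^-1) ^+ (q - i) * itilde_derive i z.

Lemma der_kummer_derive q (z : R) : is_derive z 1 (kummer_derive q) (kummer_derive q.+1 z).
Proof.
have d1 : is_derive z 1 (fun t => expR (- (t / 2))) (- 2^-1 * expR (- (z / 2))).
  refine (der_eq (der_expR (derN (derM (der_id z) (der_cst 2^-1 z)))) _); ring.
have d2 := @der_sum q.+1 (fun i t => 'C(q, i)%:R * (- 2^-1) ^+ (q - i) * itilde_derive i t) _ z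
  (fun i => derM (der_cst _ z) (der_itilde_derive i z)).
refine (der_eq (derM d1 d2) _).
rewrite /kummer_derive.
transitivity (expR (- (z / 2)) *
  (\sum_(i < q.+1) 'C(q, i)%:R * (- 2^-1) ^+ (q - i) * itilde_derive i.+1 z +
   - 2^-1 * \sum_(i < q.+1) 'C(q, i)%:R * (- 2^-1) ^+ (q - i) * itilde_derive i z)).
  rewrite mulrDr; congr (_ + _); last by ring.
  by congr (_ * _); apply: eq_bigr => i _; rewrite mulr0 addr0.
congr (_ * _).
rewrite [RHS]big_ord_recl mulr_sumr [X in _ + X]big_ord_recl /= bin0 bin0 subn0 subn0.
rewrite addrCA; congr (_ + _); first by rewrite exprS; ring.
have -> : \sum_(i < q) - 2^-1 *
  ('C(q, bump 0 i)%:R * (- 2^-1) ^+ (q - bump 0 i) * itilde_derive (bump 0 i) z) =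
   \sum_(i < q.+1) - 2^-1 * ('C(q, i.+1)%:R * (- 2^-1) ^+ (q - i.+1) * itilde_derive i.+1 z).
  by rewrite big_ord_recr /= bin_small// !mul0r mulr0 addr0.
rewrite -big_split; apply: eq_bigr => i _ /=.
rewrite /bump !add1n binS natrD subSS.
have [iq|iq] := ltnP i q; last by rewrite (@bin_small q i.+1) ?ltnS//; ring.
have -> : (q - i = (q - i.+1).+1)%N by lia.
by rewrite exprS; ring.
Qed.

(** At 0 Leibniz's rule leaves q! times a Cauchy product, which [kummer_second] evaluates. *)
Lemma kummer_derive0 q : kummer_derive q 0 = q`!%:R * (kummer_coef R b q / gamma_half R b).
Proof.
rewrite -itilde_coef0 -(kummer_second itilde_coef1 itilde_coefSS) /kummer_derive mul0r oppr0 expR0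
  mul1r.
rewrite /cauchy_conv mulr_sumr (reindex_inj rev_ord_inj); apply: eq_bigr => i _ /=.
have iq : (i <= q)%N by rewrite -ltnS.
rewrite subSS subKn// /itilde_derive pseries_sum0 iter_diffs add0n fact0 divr1 /half_exp_coef.
rewrite -(bin_fact iq) bin_sub// !natrM; field.
by rewrite pnatr_eq0 -lt0n fact_gt0.
Qed.

End KummerFunction.

(** * Iterated derivatives in t *)

Section Iterated.
Variable R : realType.

(** Iterated derivatives are identified by exhibiting a family closed under differentiation; t < 1
    is open, so equality there passes to derivatives. *)
Lemma derive1n_family (F : nat -> R -> R) (G : R -> R) :
  (forall t : R, t < 1 -> G t = F 0%N t) ->
  (forall j (t : R), t < 1 -> is_derive t 1 (F j) (F j.+1 t)) ->
  forall j (t : R), t < 1 -> derive1n j G t = F j t.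
Proof.
move=> GF dF; elim=> [|j IH] t t1; first exact: GF.
rewrite derive1nS derive1E.
have n1 : \near t, derive1n j G t = F j t.
  have : nbhs t `]-oo, (1:R)[%classic by apply: open_nbhs_nbhs; split;
    [exact: interval_open|rewrite /= in_itv/=].
  by apply: filterS => s; rewrite /= in_itv/= => s1; exact: IH.
rewrite (near_eq_derive _ n1) ?oner_neq0//.
exact: (@derive_val _ _ _ _ _ _ _ (dF j t t1)).
Qed.

Variables (b : nat) (x : R).
Let z t : R := t * x / (1 - t).
Let F c q (t : R) := (1 - t) ^- c * kummer_derive b q (z t).

Lemma der_F c q (t : R) : t < 1 ->
  is_derive t 1 (F c q) (c%:R * F c.+1 q t + x * F c.+2 q.+1 t).
Proof.
move=> t1; have t0 : 1 - t != 0 by rewrite gt_eqF// subr_gt0.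
have d1 := derB (der_cst 1 t) (der_id t).
have dp := derX c d1.
have dz := derM (derM (der_id t) (der_cst x t)) (derV (f := fun t => 1 - t) t0 d1).
refine (der_eq (derM (derV (f := fun t => (1 - t) ^+ c) _ dp)
  (der_comp dz (der_kummer_derive b q _))) _); first by rewrite expf_neq0.
rewrite /F /z; set h := kummer_derive b q _; set h' := kummer_derive b q.+1 _.
case: c dp => [|c] dp; first by field.
by rewrite !exprS/=; field; rewrite t0 expf_neq0.
Qed.

(* j-th derivative in t of (1-t)^(-C-1) h(tx/(1-t)), where h = [kummer_derive b 0] *)
Definition kummer_gen C j (t : R) := \sum_(k < j.+1)
  (j`!%:R / k`!%:R * 'C(C + j, j - k)%:R * x ^+ k) * F (C.+1 + j + k) k t.

Lemma der_kummer_gen C j (t : R) : t < 1 -> is_derive t 1 (kummer_gen C j) (kummer_gen C j.+1 t).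
Proof.
move=> t1.
have fn0 m : m`!%:R != 0 :> R by rewrite pnatr_eq0 -lt0n fact_gt0.
refine (der_eq (@der_sum _ j.+1
  (fun k t => (j`!%:R / k`!%:R * 'C(C + j, j - k)%:R * x ^+ k) * F (C.+1 + j + k) k t) _ t
  (fun k => derM (der_cst _ t) (der_F (C.+1 + j + k) k t1))) _).
rewrite /kummer_gen.
pose S1 k := j`!%:R / k`!%:R * 'C(C + j, j - k)%:R * x ^+ k * (C.+1 + j + k)%:R *
  F (C.+1 + j + k).+1 k t.
pose S2 k := j`!%:R / k`!%:R * 'C(C + j, j - k)%:R * x ^+ k.+1 * F (C.+1 + j + k).+2 k.+1 t.
transitivity (\sum_(k < j.+1) S1 k + \sum_(k < j.+1) S2 k).
  rewrite -big_split; apply: eq_bigr => k _; rewrite /S1 /S2 exprS /=; ring.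
(* The recursion in j of the numbers (j!/k!) binom(C+j, j-k), which makes the coefficients match. *)
have bE k : (k <= j)%N -> j.+1%:R * 'C(C + j.+1, j.+1 - k)%:R =
    (C.+1 + j + k)%:R * 'C(C + j, j - k)%:R + k%:R * 'C(C + j, j.+1 - k)%:R :> R.
  move=> kj; rewrite -!natrM -natrD; congr (_%:R).
  rewrite subSn// addnS binS.
  have := mul_bin_left (C + j) (j - k).
  rewrite (_ : C + j - (j - k) = C + k)%N; last by lia.
  move: 'C(C + j, (j - k).+1) 'C(C + j, j - k) => u v.
  by move: kj => /subnKC <-; rewrite addKn; nia.
pose A k := j.+1`!%:R / k`!%:R * 'C(C + j.+1, j.+1 - k)%:R * x ^+ k * F (C.+1 + j.+1 + k) k t.
have idx k : (C.+1 + j.+1 + k = (C.+1 + j + k).+1)%N by lia.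
have A0 : A 0%N = S1 0%N.
  by have := bE 0%N isT; rewrite mul0r addr0 => E; rewrite /A /S1 idx factS natrM -[RHS]mulrA;
    transitivity (j`!%:R / 0`!%:R * x ^+ 0 * (j.+1%:R * 'C(C + j.+1, j.+1 - 0)%:R) *
      F (C.+1 + j + 0).+1 0 t); [ring|rewrite E; ring].
have AS k : (k < j)%N -> A k.+1 = S1 k.+1 + S2 k.
  move=> kj; have E := bE k.+1 kj; rewrite /A /S1 /S2 idx (factS j) natrM.
  rewrite (_ : (C.+1 + j + k.+1).+1 = (C.+1 + j + k).+2)%N; last by lia.
  transitivity (j`!%:R / k.+1`!%:R * x ^+ k.+1 * (j.+1%:R * 'C(C + j.+1, j.+1 - k.+1)%:R) *
    F (C.+1 + j + k).+2 k.+1 t); first by ring.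
  rewrite E subSS factS natrM; field.
  by rewrite fn0 nat1r pnatr_eq0.
have Aj : A j.+1 = S2 j.
  rewrite /A /S2 !subnn !bin0 !divff// !mul1r.
  by congr (_ * F _ _ _); lia.
rewrite [RHS](_ : _ = \sum_(k < j.+2) A k)//.
rewrite [RHS]big_ord_recl [X in _ = _ + X]big_ord_recr /= Aj.
rewrite big_ord_recl [X in _ + X]big_ord_recr /= A0 -!addrA; congr (_ + _).
rewrite addrA; congr (_ + _); rewrite -big_split; apply: eq_bigr => k _ /=.
by rewrite AS.
Qed.
End Iterated.

(** * M_j as a multiple of N_j *)

Section Mpol.
Variables (R : realType) (l b : nat).
Hypothesis lb : (l <= b)%N.

Lemma kummer_gen0 (x : R) C t : kummer_gen b x C 0 t = (1 - t) ^- C.+1 *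
  kummer_derive b 0 (t * x / (1 - t)).
Proof. by rewrite /kummer_gen big_ord1 fact0 bin0 !addn0 divr1 expr0 !mul1r. Qed.

Lemma Ktilde_half (y : R) : 0 < y ->
  Ktilde (l%:R + 1 / 2) (y / 2) =
  2 * 4 ^+ l * Num.sqrt pi * y ^- (2 * l + 1) * expR (- (y / 2)) * (bessel_poly R l).[y].
Proof.
move=> y0; rewrite /Ktilde BesselK_half ?divr_gt0//.
have -> : y / 2 / 2 = y / 4 by field.
have y4 : 0 <= y / 4 by rewrite divr_ge0// ltW.
rewrite powRN powRD; last by rewrite gt_eqF ?implybT// divr_gt0.
rewrite powR_mulrn// -[1 / 2]/(1 * 2^-1) mul1r powR12_sqrt//.
rewrite sqrtrM ?(ltW y0)// (_ : 4^-1 = 2^-1 ^+ 2 :> R); last by rewrite expr2; field.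
rewrite sqrtr_sqr ger0_norm ?invr_ge0// /half_besselK.
have -> : 2 * (y / 2) = y by field.
have s0 : Num.sqrt y != 0 by rewrite gt_eqF// sqrtr_gt0.
have p0 : y ^+ l != 0 by rewrite expf_neq0// gt_eqF.
have e0 : 4 ^+ l != 0 :> R by rewrite expf_neq0.
rewrite exprMn (_ : 2^-1 ^+ 2 = 4^-1 :> R); last by rewrite expr2; field.
rewrite exprVn (_ : y ^+ (2 * l + 1) = y ^+ l * y ^+ l * Num.sqrt y ^+ 2); last first.
  by rewrite sqr_sqrtr ?ltW// -exprD -exprSr; congr (_ ^+ _); lia.
by field; rewrite s0 p0 e0.
Qed.

Lemma Gfun_family (x t : R) : 0 < x -> t < 1 ->
  Gfun (2 * b + 1)%:R l t x =
  Num.sqrt pi * \sum_(i < l.+1) (bessel_coef R l i * x ^+ i) * kummer_gen b x (b - l + i) 0 t.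
Proof.
move=> x0 t1; have s0 : 0 < 1 - t by rewrite subr_gt0.
have s1 : 1 - t != 0 by rewrite gt_eqF.
rewrite /Gfun.
have -> : x / (2 * (1 - t)) = x / (1 - t) / 2 by field.
rewrite Ktilde_half ?divr_gt0//.
have -> : t * x / (2 * (1 - t)) = t * x / (1 - t) / 2 by field.
rewrite Itilde_pseries_sum.
have -> : l%:R + ((2 * b + 1)%:R + 3) / 2 = (l + b + 2)%:R :> R.
  by rewrite !(natrM, natrD); field.
rewrite powRN powR_mulrn ?ltW//.
set y := x / (1 - t); set z := t * x / (1 - t).
have HE : kummer_derive b 0 z = expR (- (z / 2)) * pseries_sum (itilde_coef R b) z.
  by rewrite /kummer_derive big_ord1 /= bin0 expr0 !mul1r.
have xy : x = y * (1 - t) by rewrite /y divfK.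
(* As y - x = z, the exponential of K and the factor e^(x/2) combine to e^(-z/2), which turns Itilde
   into the Kummer function. *)
have eE : expR (x / 2) * expR (- (y / 2)) = expR (- (z / 2)).
  by rewrite -expRD; congr expR; rewrite /y /z; field.
have -> : \sum_(i < l.+1) (bessel_coef R l i * x ^+ i) * kummer_gen b x (b - l + i) 0 t =
   (1 - t) ^- (b - l).+1 * kummer_derive b 0 z * (bessel_poly R l).[y].
  rewrite /bessel_poly horner_sum mulr_sumr; apply: eq_bigr => i _.
  rewrite kummer_gen0 -/z hornerZ hornerXn /y expr_div_n -addSn exprD; field.
  by rewrite !expf_neq0.
rewrite HE -eE.
have -> : (x / 2) ^+ (2 * l + 1) = y ^+ (2 * l + 1) * (1 - t) ^+ (2 * l + 1) / (2 * 4 ^+ l).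
  rewrite expr_div_n {1}xy exprMn; congr (_ / _).
  by rewrite addn1 exprS exprM; congr (_ * _ ^+ _); rewrite expr2; ring.
(* 2l+1 of these factors cancel against (x/2)^(2l+1) rewritten in y; the other b-l+1 form the
   prefactor of the generating function. *)
have -> : (1 - t) ^+ (l + b + 2) = (1 - t) ^+ (2 * l + 1) * (1 - t) ^+ (b - l).+1.
  by rewrite -exprD; congr (_ ^+ _); lia.
have y0 : y != 0 by rewrite gt_eqF// divr_gt0.
have yn : y ^+ (2 * l + 1) != 0 by rewrite expf_neq0.
have en : 4 ^+ l != 0 :> R by rewrite expf_neq0.
have sn n : (1 - t) ^+ n != 0 by rewrite expf_neq0.
move: (y ^+ _) yn (4 ^+ l) en ((1 - t) ^+ _) (sn (2 * l + 1)%N) ((1 - t) ^+ _) (sn (b - l).+1).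
by move=> u u0 v v0 w w0 w' w0'; field; rewrite u0 v0 w0 w0'.
Qed.

Lemma derive1n_Gfun (x : R) j : 0 < x ->
  derive1n j (fun t => Gfun (2 * b + 1)%:R l t x) 0 =
  Num.sqrt pi * j`!%:R / gamma_half R b * (Npol R l b j).[x].
Proof.
move=> x0.
pose FF j (t : R) := Num.sqrt pi * \sum_(i < l.+1) (bessel_coef R l i * x ^+ i) *
  kummer_gen b x (b - l + i) j t.
have dFF k (t : R) : t < 1 -> is_derive t 1 (FF k) (FF k.+1 t).
  move=> t1.
  have d := @der_sum _ l.+1 (fun i t => (bessel_coef R l i * x ^+ i) *
    kummer_gen b x (b - l + i) k t) _ t
    (fun i => derM (der_cst _ t) (der_kummer_gen b x (b - l + i) k t1)).
  refine (der_eq (derM (der_cst (Num.sqrt pi) t) d) _).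
  by rewrite mulr0 addr0 /FF; congr (_ * _); apply: eq_bigr => i _; rewrite mulr0 addr0.
have -> : derive1n j (fun t => Gfun (2 * b + 1)%:R l t x) 0 = FF j 0.
  by apply: derive1n_family => // t t1; exact: Gfun_family.
rewrite /FF -!mulrA; congr (_ * _).
rewrite /Npol /phi horner_sum !mulr_sumr; apply: eq_bigr => i _.
rewrite /kummer_gen horner_sum !mulr_sumr; apply: eq_bigr => k _.
rewrite hornerZ hornerXn mul0r mul0r kummer_derive0 subr0 expr1n invr1 mul1r exprD !expr0 !mul1r.
field.
by rewrite pnatr_eq0 -lt0n fact_gt0 gt_eqF// gamma_half_gt0.
Qed.

(** Legendre's duplication formula; it removes sqrt pi and Gamma(b+3/2) from the normalisation of
    M_j. *)
Lemma gamma_half_closed n : gamma_half R n * (4 ^+ n.+1 * n.+1`!%:R) = Num.sqrt pi *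
  (2 * n.+1)`!%:R.
Proof.
elim: n => [|n IH].
  by rewrite /= expr1 (_ : 1`! = 1)%N// (_ : (2 * 1)`! = 2)%N//; field.
rewrite (_ : 2 * n.+2 = (2 * n.+1).+2)%N; last by lia.
rewrite [gamma_half R _]/= -/(gamma_half R n).
have fS m : m.+1`!%:R = m.+1%:R * m`!%:R :> R by rewrite factS natrM.
rewrite (fS (2 * n.+1).+1) (fS (2 * n.+1)%N) (fS n.+1) exprS.
transitivity ((n%:R + 3 / 2) * 4 * n.+2%:R * (gamma_half R n * (4 ^+ n.+1 * n.+1`!%:R))).
  by field.
rewrite IH; move: (2 * n.+1)`!%:R => w.
rewrite -[(2 * n.+1).+2]addn2 -[(2 * n.+1).+1]addn1 !natrD !natrM; by field.
Qed.

Lemma Mpol_Npol (x : R) j : 0 < x ->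
  Mpol (2 * b + 1)%:R l j x =
  (j + 2 * b + 1)`!%:R * b`!%:R / ((j + b)`!%:R * (2 * b + 1)`!%:R) * (Npol R l b j).[x].
Proof.
move=> x0; rewrite /Mpol derive1n_Gfun//.
have -> : j%:R + (2 * b + 1)%:R + 1 = (j + 2 * b + 1)%:R + 1 :> R by rewrite !(natrD, natrM); ring.
have -> : j%:R + ((2 * b + 1)%:R + 1) / 2 = (j + b)%:R + 1 :> R by rewrite !(natrD, natrM); field.
rewrite !Gamma_nat powR_mulrn//.
have := gamma_half_closed b.
have -> : (2 * b.+1 = (2 * b + 1).+1)%N by lia.
rewrite !factS !natrM.
have g0 : gamma_half R b != 0 by rewrite gt_eqF// gamma_half_gt0.
have f0 m : m`!%:R != 0 :> R by rewrite pnatr_eq0 -lt0n fact_gt0.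
have e0 : 2 ^+ (2 * b + 1) != 0 :> R by rewrite expf_neq0.
have -> : 4 ^+ b.+1 = 2 * 2 ^+ (2 * b + 1) :> R.
  by rewrite -exprS (_ : (2 * b + 1).+1 = 2 * b.+1)%N ?exprM -?natrX//; lia.
have -> : ((2 * b + 1).+1)%:R = 2 * b.+1%:R :> R by rewrite -natrM; congr (_%:R); lia.
have b0 : b.+1%:R != 0 :> R by rewrite pnatr_eq0.
move: (2 ^+ (2 * b + 1)) e0 => e e0 E.
have {}E : gamma_half R b * e * b`!%:R = Num.sqrt pi * (2 * b + 1)`!%:R.
  apply: (mulfI b0); apply: (@mulfI _ (2 : R)) => //.
  transitivity (gamma_half R b * (2 * e * (b.+1%:R * b`!%:R))); first by ring.
  by rewrite E; ring.
have -> : Num.sqrt pi = gamma_half R b * e * b`!%:R / (2 * b + 1)`!%:R by rewrite E mulfK.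
by field; rewrite g0 e0 !f0.
Qed.
End Mpol.

Section Orthogonality.
Variables (R : realType) (l b : nat).
Hypothesis lb : (l <= b)%N.
Local Notation leb := (@lebesgue_measure R).
Local Notation M j := (Mpol (2 * b + 1)%:R l j).

Definition kappa j : R := (j + 2 * b + 1)`!%:R * b`!%:R / ((j + b)`!%:R * (2 * b + 1)`!%:R).

Lemma kappa_neq0 j : kappa j != 0.
Proof.
have f0 m : m`!%:R != 0 :> R by rewrite pnatr_eq0 -lt0n fact_gt0.
by rewrite /kappa !mulf_neq0 ?invr_eq0 ?mulf_neq0.
Qed.

Lemma MpolM_weight j k x : 0 < x -> M j x * M k x * weight (2 * b + 1) l x =
  ((kappa j * kappa k) *: ('X^(2 * (b - l) + 1) * (Npol R l b j * Npol R l b k))).[x] * expR (- x).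
Proof.
move=> x0; rewrite !Mpol_Npol// /weight hornerZ !hornerM hornerXn -/(kappa j) -/(kappa k).
have -> : (2 * b + 1 - 2 * l = 2 * (b - l) + 1)%N by lia.
ring.
Qed.

Lemma integrable_MpolM j k : leb.-integrable (`]0%R, +oo[ : set R)
  (fun x => (M j x * M k x * weight (2 * b + 1) l x)%:E).
Proof.
apply: eq_integrable; last exact: (integrable_horner_expRN
  ((kappa j * kappa k) *: ('X^(2 * (b - l) + 1) * (Npol R l b j * Npol R l b k)))).
- by [].
- by move=> x; rewrite inE/= in_itv/= andbT => x0; rewrite MpolM_weight.
Qed.

Lemma integral_MpolM j k : (\int[leb]_(x in `]0%R,
  +oo[) (M j x * M k x * weight (2 * b + 1) l x)%:E =
  (kappa j * kappa k * gram R l b j k)%:E)%E.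
Proof.
rewrite -laplZ -integral_horner_expRN; apply: eq_integral => x.
by rewrite inE/= in_itv/= andbT => x0; rewrite MpolM_weight.
Qed.

(** With mu = 2b+1 all Gamma arguments are positive integers, and the claim is [gram_closed] scaled
    by kappa_j^2. *)
Lemma MpolM_norm j : kappa j * kappa j * gram R l b j j =
  2 * Gamma (j%:R + (2 * b + 1)%:R + 1) * Gamma (j%:R + l%:R + ((2 * b + 1)%:R + 3) / 2)
    * Gamma (j%:R - l%:R + ((2 * b + 1)%:R + 1) / 2)
  / (j`!%:R * (2 * j%:R + (2 * b + 1)%:R + 1) * Gamma (j%:R + ((2 * b + 1)%:R + 1) / 2) ^+ 2).
Proof.
have -> : j%:R + (2 * b + 1)%:R + 1 = (j + 2 * b + 1)%:R + 1 :> R by rewrite !(natrD, natrM); ring.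
have -> : j%:R + l%:R + ((2 * b + 1)%:R + 3) / 2 = (j + l + b + 1)%:R +
  1 :> R by rewrite !(natrM, natrD); field.
have -> : j%:R - l%:R + ((2 * b + 1)%:R + 1) / 2 = (j + b - l)%:R + 1 :> R.
  by rewrite natrB ?(leq_trans lb) ?leq_addl// !(natrM, natrD); field.
have -> : j%:R + ((2 * b + 1)%:R + 1) / 2 = (j + b)%:R + 1 :> R by rewrite !(natrD, natrM); field.
rewrite !Gamma_nat.
have -> : 2 * j%:R + (2 * b + 1)%:R + 1 = 2 * (j + b + 1)%:R :> R by rewrite !(natrM, natrD); ring.
have f0 m : m`!%:R != 0 :> R by rewrite pnatr_eq0 -lt0n fact_gt0.
have jb0 : (j + b + 1)%:R != 0 :> R by rewrite pnatr_eq0 addn1.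
have := gram_closed R lb j; rewrite !natrM => E.
have -> : gram R l b j j = (2 * b + 1)`!%:R ^+ 2 * (j + l + b + 1)`!%:R * (j + b - l)`!%:R /
   ((j + 2 * b + 1)`!%:R * j`!%:R * (j + b + 1)%:R * (b`!%:R * b`!%:R)).
  by rewrite expr2 -E mulfK// !mulf_neq0.
rewrite /kappa; move: (j + b + 1)%:R jb0 => w w0; field; by rewrite !f0 w0.
Qed.
End Orthogonality.

(** * Density of polynomials *)

Section L2closure.
Variables (R : realType) (n : nat).
Local Notation leb := (@lebesgue_measure R).
Local Notation I := (`]0%R, +oo[%classic : set R).
Let w (x : R) := x ^+ n * expR (- x).

Definition sqint (f : R -> R) : \bar R := (\int[leb]_(x in I) ((f x) ^+ 2 * w x)%:E)%E.

Let mI : measurable I. Proof. by []. Qed.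

Lemma itv0y_gt0 (x : R) : I x -> 0 < x.
Proof. by rewrite /= in_itv/= andbT. Qed.

Let w_ge0 x : I x -> 0 <= w x.
Proof. by move=> /itv0y_gt0 x0; rewrite mulr_ge0 ?expR_ge0 ?exprn_ge0 ?ltW. Qed.

Let mw : measurable_fun I w.
Proof.
apply: measurable_funTS; apply: continuous_measurable_fun.
have -> : w = (fun x => 'X^n.[x] * expR (- x)) by apply/funext => x; rewrite hornerXn.
exact: continuous_horner_expRN.
Qed.

Let mEF (f : R -> R) : measurable_fun I f -> measurable_fun I (fun x => ((f x) ^+ 2 * w x)%:E).
Proof. by move=> mf; apply/measurable_EFinP; apply: measurable_funM => //;
  exact: measurable_funX. Qed.

Let sq_ge0 (f : R -> R) x : I x -> (0 <= ((f x) ^+ 2 * w x)%:E)%E.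
Proof. by move=> Ix; rewrite lee_fin mulr_ge0 ?sqr_ge0 ?w_ge0. Qed.

Lemma sqint_ge0 f : (0 <= sqint f)%E.
Proof. by apply: integral_ge0 => x; exact: sq_ge0. Qed.

Lemma eq_sqint (f g : R -> R) : (forall x, 0 < x -> f x = g x) -> sqint f = sqint g.
Proof. by move=> h; apply: eq_integral => x; rewrite inE => /itv0y_gt0 x0; rewrite h. Qed.

Lemma le_sqint (f g : R -> R) : measurable_fun I f -> measurable_fun I g ->
  (forall x, 0 < x -> `|f x| <= `|g x|) -> (sqint f <= sqint g)%E.
Proof.
move=> mf mg h; apply: ge0_le_integral => //; [exact: sq_ge0|exact: mEF|exact: mEF|].
move=> x Ix; rewrite lee_fin ler_wpM2r ?w_ge0//.
by rewrite -(real_normK (num_real (f x))) -(real_normK (num_real (g x))) lerXn2r ?nnegrE// h//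
  itv0y_gt0.
Qed.

Lemma sqintZ c (f : R -> R) : measurable_fun I f ->
  sqint (fun x => c * f x) = ((c ^+ 2)%:E * sqint f)%E.
Proof.
move=> mf; rewrite /sqint -ge0_integralZl_EFin ?sqr_ge0//; last 2 first.
- exact: sq_ge0.
- exact: mEF.
by apply: eq_integral => x _; rewrite -EFinM; congr (_%:E); ring.
Qed.

(** (f+g)^2 <= 2f^2 + 2g^2 serves in place of the triangle inequality. *)
Lemma sqintD_lt (f g : R -> R) a b : measurable_fun I f -> measurable_fun I g ->
  (sqint f < a%:E)%E -> (sqint g < b%:E)%E ->
  (sqint (fun x => f x + g x)%R < (2 * (a + b))%:E)%E.
Proof.
move=> mf mg fa gb.
apply: (@le_lt_trans _ _ (2%:E * (sqint f + sqint g))%E); last first.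
  rewrite EFinM lte_pmul2l// EFinD lteD//.
rewrite /sqint -ge0_integralD//; [|exact: sq_ge0|exact: mEF|exact: sq_ge0|exact: mEF].
rewrite -ge0_integralZl_EFin//; last 2 first.
- by move=> x Ix; rewrite adde_ge0 ?sq_ge0.
- by apply: emeasurable_funD; exact: mEF.
apply: ge0_le_integral => //.
- exact: sq_ge0.
- by apply: mEF; exact: measurable_funD.
- by apply: measurable_funeM; apply: emeasurable_funD; exact: mEF.
move=> x Ix; rewrite -EFinD -EFinM lee_fin -mulrDl mulrA ler_wpM2r ?w_ge0//.
have := sqr_ge0 (f x - g x); rewrite -subr_ge0 => h.
rewrite -subr_ge0; apply: le_trans h _; lra.
Qed.

Lemma sqint_dominated (f : R -> R) (g_ : nat -> R -> R) (h : R -> R) :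
  measurable_fun I f -> (forall k, measurable_fun I (g_ k)) -> measurable_fun I h ->
  (sqint h < +oo)%E ->
  (forall x k, 0 < x -> `|f x - g_ k x| <= `|h x|) ->
  (forall x, 0 < x -> g_ k x @[k --> \oo] --> f x) ->
  forall eps : R, 0 < eps -> exists k, (sqint (fun x => f x - g_ k x)%R < eps%:E)%E.
Proof.
move=> mf mg mh hoo fgh gf eps e0.
have mfg k : measurable_fun I (fun x => f x - g_ k x) by exact: measurable_funB.
have [] := @dominated_convergence _ _ _ leb I mI
  (fun k x => ((f x - g_ k x) ^+ 2 * w x)%:E) (fun=> 0%E) (fun x => ((h x) ^+ 2 * w x)%:E).
- by move=> k; exact: (mEF (mfg k)).
- exact: measurable_cst.
- apply: aeW => x Ix; apply: cvg_EFin; first exact: nearW.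
  have gx := gf x (itv0y_gt0 Ix).
  have c1 : f x - g_ k x @[k --> \oo] --> (0 : R).
    by have := cvgB (cvg_cst (f x)) gx; rewrite subrr; apply.
  have := @cvgMr_tmp _ _ _ _ _ _ (w x) (cvgM c1 c1); rewrite mul0r mul0r.
  by apply.
- apply/integrableP; split; first exact: mEF.
  apply: le_lt_trans hoo; apply: ge0_le_integral => //.
  + by apply: measurableT_comp => //; exact: mEF.
  + exact: mEF.
  + by move=> x Ix; rewrite gee0_abs// sq_ge0.
- apply: aeW => x k Ix; rewrite gee0_abs ?(sq_ge0 (fun x => f x - g_ k x))//.
  rewrite lee_fin ler_wpM2r ?w_ge0//.
  by rewrite -(real_normK (num_real (f x - _))) -(real_normK (num_real (h x))) lerXn2r ?nnegrE//
    fgh// itv0y_gt0.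
move=> _ _; rewrite integral0 => c.
have : nbhs (0%E : \bar R) [set y | (y < eps%:E)%E].
  by apply: open_nbhs_nbhs; split; [exact: open_ereal_lt_ereal|rewrite /= lte_fin].
move=> /c [N _ /(_ N (leqnn _))] /= hN.
by exists N.
Qed.

(** Membership in the L^2 closure of the polynomials; measurability is bundled because the estimates
    on [sqint] ask for it. *)
Definition poly_approx (f : R -> R) := measurable_fun I f /\
  forall eps : R, 0 < eps -> exists p : {poly R}, (sqint (fun x => f x - p.[x])%R < eps%:E)%E.

Let mhorner (p : {poly R}) : measurable_fun I (horner p).
Proof.
apply: measurable_funTS; apply: continuous_measurable_fun => x.
exact: (der_cvg (is_derive_poly p x)).
Qed.

Lemma poly_approx_lim (f : R -> R) : measurable_fun I f ->
  (forall eps : R, 0 < eps -> exists2 g, poly_approx g &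
    (sqint (fun x => (f x - g x)%R) < eps%:E)%E) ->
  poly_approx f.
Proof.
move=> mf h; split=> // eps e0.
have e4 : 0 < eps / 4 by rewrite divr_gt0.
have [g [mg ga] fg] := h _ e4; have [p gp] := ga _ e4; exists p.
have -> : eps = 2 * (eps / 4 + eps / 4) by field.
rewrite (@eq_sqint _ (fun x => (f x - g x) + (g x - p.[x]))); last by move=> x _; ring.
by apply: sqintD_lt => //; apply: measurable_funB.
Qed.

Lemma poly_approxD f g : poly_approx f -> poly_approx g -> poly_approx (fun x => f x + g x).
Proof.
move=> [mf fa] [mg ga]; split; first exact: measurable_funD.
move=> eps e0; have e4 : 0 < eps / 4 by rewrite divr_gt0.
have [p fp] := fa _ e4; have [q gq] := ga _ e4; exists (p + q).
have -> : eps = 2 * (eps / 4 + eps / 4) by field.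
rewrite (@eq_sqint _ (fun x => (f x - p.[x]) + (g x - q.[x]))); last first.
  by move=> x _; rewrite hornerD; ring.
by apply: sqintD_lt => //; apply: measurable_funB.
Qed.

Lemma poly_approxZ c f : poly_approx f -> poly_approx (fun x => c * f x).
Proof.
move=> [mf fa]; split; first exact: measurable_funM.
move=> eps e0; have c0 : 0 < c ^+ 2 + 1 by rewrite ltr_wpDl ?sqr_ge0.
have [p fp] := fa _ (divr_gt0 e0 c0); exists (c *: p).
rewrite (@eq_sqint _ (fun x => c * (f x - p.[x]))); last first.
  by move=> x _; rewrite hornerZ; ring.
rewrite sqintZ; last exact: measurable_funB.
apply: (@le_lt_trans _ _ ((c ^+ 2 + 1)%:E * sqint (fun x => f x - p.[x])%R)%E).
  by rewrite lee_wpmul2r ?sqint_ge0// lee_fin lerDl.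
have -> : eps = (c ^+ 2 + 1) * (eps / (c ^+ 2 + 1)) by field; rewrite gt_eqF.
by rewrite [ltRHS]EFinM lte_pmul2l// lte_fin.
Qed.

Lemma sqint_horner (p : {poly R}) : sqint (horner p) = (lapl ('X^n * p ^+ 2))%:E.
Proof.
rewrite -integral_horner_expRN; apply: eq_integral => x _; congr _%:E.
by rewrite hornerM hornerXn horner_exp /w; ring.
Qed.

Lemma sqint0 : sqint (fun=> 0) = 0%E.
Proof. by rewrite /sqint; apply: integral0_eq => x _; rewrite expr0n mul0r. Qed.

Lemma poly_approx_poly (p : {poly R}) : poly_approx (horner p).
Proof.
split; first exact: mhorner.
move=> eps e0; exists p; rewrite (@eq_sqint _ (fun=> 0)) ?sqint0 ?lte_fin//.
by move=> x _; rewrite subrr.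
Qed.

Lemma eq_poly_approx (f g : R -> R) : (forall x, 0 < x -> f x = g x) -> poly_approx f ->
  poly_approx g.
Proof.
move=> fg [mf fa]; split.
  by apply: eq_measurable_fun mf => x; rewrite inE => /itv0y_gt0 x0; rewrite fg.
move=> eps /fa[p fp]; exists p; rewrite (@eq_sqint _ (fun x => f x - p.[x]))//.
by move=> x x0; rewrite fg.
Qed.

Lemma poly_approx_sum (T : Type) (s : seq T) (f : T -> R -> R) :
  (forall i, poly_approx (f i)) -> poly_approx (fun x => \sum_(i <- s) f i x).
Proof.
move=> h; elim: s => [|i s IH].
  apply: (@eq_poly_approx (horner 0)); last exact: poly_approx_poly.
  by move=> x _; rewrite horner0 big_nil.
by under eq_fun do rewrite big_cons; exact: poly_approxD.
Qed.
End L2closure.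

(** * Taylor remainders of e^(-u) *)

Section Taylor.
Variable R : realType.

Definition exp_taylor N (u : R) : R := \sum_(i < N) (-1) ^+ i / i`!%:R * u ^+ i.

(** The signed remainders satisfy r_{N+1}' = r_N and r_{N+1}(0) = 0, so both bounds pass from N to
    N+1 by monotonicity. *)
Lemma exp_taylor_remainder N (u : R) : 0 <= u ->
  0 <= (-1) ^+ N * (expR (- u) - exp_taylor N u) <= u ^+ N / N`!%:R.
Proof.
pose r N (u : R) := (-1) ^+ N * (expR (- u) - exp_taylor N u).
have dT k (t : R) : is_derive t 1 (exp_taylor k.+1) (- exp_taylor k t).
  refine (der_eq (@der_sum _ k.+1 (fun i t => (-1) ^+ i / i`!%:R * t ^+ i) _ t
    (fun i => derM (der_cst _ t) (derX i (der_id t)))) _).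
  rewrite big_ord_recl /= mulr0 addr0 mul0r mul0r mulr0 add0r -sumrN.
  apply: eq_bigr => i _; rewrite /bump add1n exprS factS natrM mulr0 addr0 /=.
  by field; rewrite nat1r !pnatr_eq0 -lt0n fact_gt0.
have dr k (t : R) : is_derive t 1 (r k.+1) (r k t).
  refine (der_eq (derM (der_cst _ t) (derB (der_expR (derN (der_id t))) (dT k t))) _).
  by rewrite /r exprS; ring.
have mono (f g : R -> R) : (forall t : R, is_derive t 1 f (g t)) ->
  (forall t, 0 <= t -> 0 <= g t) ->
    forall t, 0 <= t -> f 0 <= f t.
  move=> df g0 t t0; apply: (@ger0_derive1_ndecry _ f 0) => //.
  - move=> x; rewrite in_itv/= andbT => x0.
    rewrite derive1E (@derive_val _ _ _ _ _ _ _ (df x)).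
    by apply: g0; exact: ltW.
  - apply: continuous_subspaceT => x; exact: (der_cvg (df x)).
have r0 k : r k.+1 0 = 0.
  rewrite /r /exp_taylor big_ord_recl /= big1 => [|i _]; last by rewrite expr0n mulr0.
  by rewrite expr0 fact0 divr1 mulr1 addr0 oppr0 expR0 subrr mulr0.
elim: N u => [|N IH] u u0.
  rewrite /exp_taylor big_ord0 subr0 expr0 fact0 mul1r divr1 expR_ge0 /=.
  by rewrite expR_le1 oppr_le0 u0.
apply/andP; split.
  by have := mono _ _ (dr N) (fun t t0 => proj1 (andP (IH t t0))) u u0; rewrite r0.
have d2 (t : R) : is_derive t 1 (fun u => u ^+ N.+1 / N.+1`!%:R - r N.+1 u)
  (t ^+ N / N`!%:R - r N t).
  refine (der_eq (derB (derM (derX N.+1 (der_id t)) (der_cst _ t)) (dr N t)) _).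
  by rewrite factS natrM /=; field; rewrite nat1r !pnatr_eq0 -lt0n fact_gt0.
have := mono _ _ d2 _ u u0; rewrite r0 exprS mul0r mul0r subrr subr_ge0; apply.
by move=> t t0; rewrite subr_ge0; case/andP: (IH t t0).
Qed.

Lemma exp_taylor_le N (u : R) : 0 <= u -> `|expR (- u) - exp_taylor N u| <= u ^+ N / N`!%:R.
Proof.
move=> u0; have /andP[h1 h2] := exp_taylor_remainder N u0.
by rewrite -(ger0_norm h1) normrM normrX normrN1 expr1n mul1r in h2.
Qed.

Lemma bin_le_exp2 m k : ('C(m, k) <= 2 ^ m)%N.
Proof.
elim: m k => [|m IH] [|k] //; first by rewrite bin0 expn_gt0.
by rewrite binS expnS mul2n -addnn leq_add.
Qed.

Lemma fact_add_le m k : ((m + k)`! <= 2 ^ (m + k) * (m`! * k`!))%N.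
Proof.
have mk : (k <= m + k)%N by rewrite leq_addl.
rewrite -(bin_fact mk) addnK [(k`! * _)%N]mulnC leq_mul2r bin_le_exp2 orbT//.
Qed.
End Taylor.

Section Density.
Variables (R : realType) (n : nat).
Local Notation leb := (@lebesgue_measure R).
Local Notation I := (`]0%R, +oo[%classic : set R).
Local Notation poly_approx := (@poly_approx R n).
Local Notation sqint := (@sqint R n).

Let mI_cont (f : R -> R) : continuous f -> measurable_fun I f.
Proof. by move=> cf; apply: measurable_funTS; apply: continuous_measurable_fun. Qed.

(** One factor e^(-x/8) at a time is replaced by its Taylor polynomial: the bound (x/8)^N/N! is
    small in norm against e^(-x), while the corresponding bound (kx/8)^N/N! is not for large k. The
    remaining factor is at most 1. *)
Lemma poly_approx_Xn_expR m k : poly_approx (fun x => x ^+ m * expR (- (k%:R * x / 8))).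
Proof.
have ce k' m' : measurable_fun I (fun x : R => x ^+ m' * expR (- (k'%:R * x / 8))).
  apply: mI_cont => x.
  exact: (der_cvg (derM (derX m' (der_id x))
    (der_expR (derN (derM (derM (der_cst k'%:R x) (der_id x)) (der_cst 8^-1 x)))))).
elim: k m => [|k IH] m.
  apply: (@eq_poly_approx _ _ (horner 'X^m)); last exact: poly_approx_poly.
  by move=> x _; rewrite hornerXn mul0r mul0r oppr0 expR0 mulr1.
apply: poly_approx_lim; first exact: ce.
move=> eps e0.
pose q := (n + 2 * m)%N.
(* From (q+2N)! <= 2^(q+2N) q! (2N)! and (2N)! <= 4^N N!^2, the squared error is at most C 16^N /
   64^N = C / 4^N. *)
pose C : R := (2 ^ q * q`!)%:R.
have [N NC] : exists N, C / eps < N%:R.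
  by exists (Num.trunc (C / eps)).+1; exact: truncnS_gt.
pose g (x : R) := x ^+ m * expR (- (k%:R * x / 8)) * exp_taylor N (x / 8).
have ag : poly_approx g.
  apply: (@eq_poly_approx _ _ (fun x => \sum_(i <- index_enum 'I_N) ((-1) ^+ i / i`!%:R * 8 ^- i) *
    (x ^+ (m + i) * expR (- (k%:R * x / 8))))).
    move=> x _; rewrite /g /exp_taylor mulr_sumr; apply: eq_bigr => i _.
    by rewrite exprD expr_div_n; ring.
  by apply: poly_approx_sum => i; exact: poly_approxZ.
exists g => //.
pose c : R := (8 ^+ N * N`!%:R)^-1.
apply: (@le_lt_trans _ _ (sqint (horner (c *: 'X^(m + N))))).
  apply: le_sqint.
  - by apply: measurable_funB; [exact: ce|case: ag].
  - by case: (poly_approx_poly n (c *: 'X^(m + N))).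
  - move=> x x0; rewrite /g.
    have -> : x ^+ m * expR (- (k.+1%:R * x / 8)) - x ^+ m * expR (- (k%:R * x / 8)) *
      exp_taylor N (x / 8) =
      x ^+ m * expR (- (k%:R * x / 8)) * (expR (- (x / 8)) - exp_taylor N (x / 8)).
      have -> : - (k.+1%:R * x / 8) = - (k%:R * x / 8) + - (x / 8) by rewrite -natr1; field.
      by rewrite expRD; ring.
    have x8 : 0 <= x / 8 by rewrite divr_ge0// ltW.
    rewrite !normrM hornerZ hornerXn normrM.
    have -> : `|c| * `|x ^+ (m + N)| = (`|x ^+ m| * 1) * ((x / 8) ^+ N / N`!%:R).
      rewrite mulr1 !ger0_norm ?exprn_ge0 ?(ltW x0) ?invr_ge0 ?mulr_ge0 ?exprn_ge0//.
      rewrite exprD expr_div_n /c; field.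
      by rewrite pnatr_eq0 -lt0n fact_gt0 expf_neq0.
    apply: ler_pM => //.
      rewrite ler_wpM2l// ger0_norm ?expR_ge0// expR_le1 oppr_le0.
      by rewrite divr_ge0// mulr_ge0// ltW.
    exact: exp_taylor_le.
rewrite sqint_horner lte_fin.
have -> : 'X^n * (c *: 'X^(m + N)) ^+ 2 = c ^+ 2 *: 'X^(q + 2 * N) :> {poly R}.
  rewrite exprZn -scalerAr -exprM -exprD; congr (_ *: 'X^_); rewrite /q; lia.
rewrite laplZ.
have -> : lapl ('X^(q + 2 * N)) = (q + 2 * N)`!%:R :> R.
  rewrite /lapl size_polyXn big_ord_recr /= coefXn eqxx mul1r big1 ?add0r// => i _.
  by rewrite coefXn ltn_eqF ?mul0r.
have f1 : (q + 2 * N)`!%:R <= C * (4 ^+ N) ^+ 2 * N`!%:R ^+ 2 :> R.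
  rewrite /C -!natrX -!natrM ler_nat.
  apply: leq_trans (fact_add_le q (2 * N)) _.
  have h : ((2 * N)`! <= 4 ^ N * N`! ^ 2)%N.
    have := fact_add_le N N; rewrite addnn -mul2n => h; apply: leq_trans h _.
    by rewrite expnM mulnn.
  rewrite expnD expnM.
  apply: (@leq_trans (2 ^ q * 4 ^ N * (q`! * (4 ^ N * N`! ^ 2)))%N).
    by rewrite !leq_mul.
  by rewrite -(mulnn (4 ^ N)); nia.
have fN : N`!%:R != 0 :> R by rewrite pnatr_eq0 -lt0n fact_gt0.
apply: (@le_lt_trans _ _ (C / 4 ^+ N)).
  apply: (@le_trans _ _ (c ^+ 2 * (C * (4 ^+ N) ^+ 2 * N`!%:R ^+ 2))).
    by rewrite ler_wpM2l ?sqr_ge0.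
  rewrite /c (_ : 8 ^+ N = 4 ^+ N * 2 ^+ N); last by rewrite -exprMn; congr (_ ^+ _);
    rewrite -natrM.
  rewrite (_ : 4 ^+ N = 2 ^+ N * 2 ^+ N); last by rewrite -exprMn; congr (_ ^+ _); rewrite -natrM.
  have e : 2 ^+ N != 0 :> R by rewrite expf_neq0.
  by move: (2 ^+ N) e => u u0; rewrite le_eqVlt; apply/orP; left; apply/eqP; field; rewrite fN u0.
rewrite ltr_pdivrMr ?exprn_gt0// mulrC -ltr_pdivrMr//.
apply: lt_trans NC _; rewrite -natrX ltr_nat ltn_expl//.
Qed.
End Density.

Import HBNNSimple.

(** * From double exponentials to all square-integrable functions *)

Section Indicators.
Variables (R : realType) (n : nat).
Local Notation leb := (@lebesgue_measure R).
Local Notation I := (`]0%R, +oo[%classic : set R).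
Local Notation poly_approx := (@poly_approx R n).
Local Notation sqint := (@sqint R n).

Lemma sqint_cst_lty (c : R) : (sqint (fun=> c) < +oo)%E.
Proof.
rewrite (@eq_sqint _ _ _ (horner c%:P)) ?sqint_horner ?ltry//.
by move=> x _; rewrite hornerC.
Qed.

Lemma poly_approx_cst (c : R) : poly_approx (fun=> c).
Proof.
by apply: (@eq_poly_approx _ _ (horner c%:P));
  [move=> x _; rewrite hornerC|exact: poly_approx_poly].
Qed.

(** The inner function v is bounded by V on x > 0, so its Taylor polynomials converge uniformly to
    e^(-v); the power v^i is a multiple of e^(-kix) = e^(-(8ki)x/8), already in the closure. *)
Lemma poly_approx_double_exp (k : nat) (d : R) :
  poly_approx (fun x => expR (- (k%:R * expR (- (k%:R * (x - d)))))).
Proof.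
pose v (x : R) := k%:R * expR (- (k%:R * (x - d))).
have v0 x : 0 <= v x by rewrite mulr_ge0 ?expR_ge0.
have cv : continuous v.
  move=> x; exact: (der_cvg (derM (der_cst k%:R x)
    (der_expR (derN (derM (der_cst k%:R x) (derB (der_id x) (der_cst d x))))))).
have mf : measurable_fun I (fun x => expR (- v x)).
  apply: measurable_funTS; apply: continuous_measurable_fun => x.
  apply: continuous_comp; last exact: continuous_expR.
  by apply: continuousN; exact: cv.
pose V := k%:R * expR (k%:R * d).
have vV x : 0 < x -> v x <= V.
  move=> x0; rewrite ler_wpM2l// ler_expR mulrBr opprB gerBl mulr_ge0// ltW//.
have V0 : 0 <= V by rewrite mulr_ge0 ?expR_ge0.
have ag N : poly_approx (fun x => exp_taylor N (v x)).
  apply: (@eq_poly_approx _ _ (fun x => \sum_(i <- index_enum 'I_N)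
     ((-1) ^+ i / i`!%:R * V ^+ i) * (x ^+ 0 * expR (- ((8 * (k * i))%:R * x / 8))))).
    move=> x _; rewrite /exp_taylor; apply: eq_bigr => i _; rewrite -mulrA; congr (_ * _).
    rewrite /v /V expr0 mul1r !exprMn -!expRM_natl -[LHS]mulrA -expRD; congr (_ * expR _).
    by rewrite !natrM; field.
  by apply: poly_approx_sum => i; apply: poly_approxZ; exact: poly_approx_Xn_expR.
have bnd x N : 0 < x -> `|expR (- v x) - exp_taylor N (v x)| <= V ^+ N / N`!%:R.
  move=> x0; apply: le_trans (exp_taylor_le N (v0 x)) _.
  by rewrite ler_wpM2r// lerXn2r ?nnegrE// vV.
have c0 : V ^+ N / N`!%:R @[N --> \oo] --> (0 : R).
  exact: (cvg_series_cvg_0 (is_cvg_series_exp_coeff V)).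
apply: poly_approx_lim => // eps e0.
have [|//|//|x N x0|x x0|N h] :=
  @sqint_dominated R n _ (fun N x => exp_taylor N (v x)) (fun=> expR V) mf _ _ _ _ _ eps e0.
- by move=> N; case: (ag N).
- exact: sqint_cst_lty.
- apply: le_trans (bnd x N x0) _; rewrite [leRHS]ger0_norm ?expR_ge0//.
  case: N => [|N]; first by rewrite expr0 fact0 divr1 -expR0 ler_expR.
  by apply: le_trans (expR_ge1Dxn N V0); rewrite lerDr.
- apply/cvgrPdist_le => e e'; have /cvgrPdist_le/(_ e e') := c0.
  apply: filterS => N; rewrite sub0r normrN => h.
  by apply: le_trans (bnd x N x0) (le_trans (ler_norm _) h).
by exists (fun x => exp_taylor N (v x)).
Qed.

Lemma poly_approx_ray (d : R) : poly_approx (\1_(`]d, +oo[%classic) : R -> R).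
Proof.
pose g (k : nat) (x : R) := expR (- (k.+1%:R * expR (- (k.+1%:R * (x - d))))).
have mray : measurable_fun I (\1_(`]d, +oo[%classic) : R -> R) by exact: measurable_indic.
have harm : (fun k : nat => k.+1%:R^-1 : R) @ \oo --> (0 : R) by exact: cvg_harmonic.
have g01 k x : 0 <= g k x <= 1.
  by rewrite expR_ge0 /= expR_le1 oppr_le0 mulr_ge0 ?expR_ge0.
apply: poly_approx_lim => // eps e0.
have [|//|//|x N x0|x x0|N h] := @sqint_dominated R n _ g (fun=> 1) mray _ _ _ _ _ eps e0.
- by move=> k; case: (poly_approx_double_exp k.+1 d).
- exact: sqint_cst_lty.
- rewrite indicE normr1 ler_norml; have := g01 N x.
  by case: (_ \in _) => /=; lra.
- rewrite indicE /g; case: (ltP d x) => dx.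
    rewrite mem_set/=; last by rewrite in_itv/= dx.
    have D0 : 0 < x - d by rewrite subr_gt0.
    move: (x - d) D0 => D D0.
    (* For x > d the inner term is O(1/k), by e^s >= s^2/2. *)
    have u k : k.+1%:R * expR (- (k.+1%:R * D)) <= 2 / D ^+ 2 * k.+1%:R^-1.
      have k0 : 0 < k.+1%:R :> R by rewrite ltr0n.
      rewrite expRN ler_pdivrMr ?expR_gt0//.
      have kD : 0 <= k.+1%:R * D by rewrite mulr_ge0// ltW.
      have h : (k.+1%:R * D) ^+ 2 / 2 <= expR (k.+1%:R * D).
        by apply: le_trans (expR_ge1Dxn 1 kD); rewrite lerDr.
      apply: le_trans (ler_wpM2l _ h); last by rewrite mulr_ge0 ?invr_ge0 ?divr_ge0 ?sqr_ge0 ?ltW.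
      by rewrite le_eqVlt; apply/orP; left; apply/eqP; field; rewrite !gt_eqF.
    have c1 : 1 - 2 / D ^+ 2 * k.+1%:R^-1 @[k --> \oo] --> (1 : R).
      by have := cvgB (cvg_cst (1 : R)) (@cvgMl_tmp _ _ _ _ _ (2 / D ^+ 2) _ harm);
        rewrite mulr0 subr0; apply.
    apply: (@squeeze_cvgr _ _ _ _ _ (fun=> 1) _ _ _ c1); last exact: cvg_cst.
    apply: nearW => k; apply/andP; split.
      apply: le_trans (expR_ge1Dx _); rewrite lerD2l lerN2; exact: u.
    by rewrite expR_le1 oppr_le0 mulr_ge0 ?expR_ge0.
  (* For x <= d, the end point included, the inner term is at least k+1, so g_k <= 1/(k+1). *)
  rewrite memNset/=; last by rewrite in_itv/= andbT; apply/negP; rewrite -leNgt.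
  apply: (@squeeze_cvgr _ _ _ _ (fun=> 0) (fun k : nat => k.+1%:R^-1)) => //; last exact: cvg_cst.
  apply: nearW => k; rewrite expR_ge0 /= /g expRN lef_pV2 ?posrE ?expR_gt0//.
  apply: le_trans (expR_ge1Dx _); rewrite -[leLHS]add0r lerD//.
  rewrite ler_peMr// -expR0 ler_expR oppr_ge0 mulr_ge0_le0// subr_le0//.
exists (g N) => //; exact: poly_approx_double_exp.
Qed.

(** Dynkin's pi-lambda theorem: open rays are stable under intersection and generate the Borel sets;
    the closure is stable under complement and, by dominated convergence, under countable disjoint
    unions. *)
Lemma poly_approx_indic (A : set R) : measurable A -> poly_approx (\1_A : R -> R).
Proof.
move=> mA.
have mind (B : set R) : measurable B -> measurable_fun I (\1_B : R -> R) by move=> mB;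
  exact: measurable_indic.
apply: (@dynkin_induction _ (measurableTypeR R) (@RGenOInfty.G R)
  (fun A => poly_approx (\1_A : R -> R))).
- exact: RGenOInfty.measurableE.
- move=> _ _ [x ->] [y ->]; exists (Num.max x y).
  apply/seteqP; split => z /=; rewrite !in_itv/= !andbT gt_max.
    by case=> -> ->.
  by case/andP.
- by apply: eq_poly_approx (poly_approx_cst 1) => x _; rewrite indicT.
- by move=> _ [x ->]; exact: poly_approx_ray.
- move=> S mS aS; apply: (@eq_poly_approx _ _ (fun x => 1 + (-1) * \1_S x)).
    by move=> x _; rewrite !indicE in_setC; case: (x \in S); rewrite ?mulr1 ?subrr// mulr0 addr0.
  by apply: poly_approxD; [exact: poly_approx_cst|exact: poly_approxZ].
- move=> F mF tF aF.
  have mU : measurable (\bigcup_k F k) by exact: bigcup_measurable.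
  have sumE x i k : F i x -> \sum_(j < k) \1_(F j) x = (i < k)%:R :> R.
    move=> Fix; have E j : \1_(F j) x = (j == i)%:R :> R.
      rewrite indicE; case: eqP => [->|ji]; first by rewrite mem_set.
      rewrite memNset// => Fjx; apply: ji.
      by apply: (tF j i) => //; exists x.
    under eq_bigr do rewrite E.
    case: ltnP => ik.
      rewrite (bigD1 (Ordinal ik))//= eqxx big1 ?addr0// => j ji.
      by rewrite (_ : (j == i :> nat) = false)//; apply/negbTE; apply: contra ji => /eqP e;
        apply/eqP/val_inj.
    by rewrite big1// => j _; rewrite (ltn_eqF (leq_trans (ltn_ord j) ik)).
  have agk k : poly_approx (fun x => \sum_(j < k) \1_(F j) x) by apply: poly_approx_sum => j;
    exact: aF.
  apply: poly_approx_lim; first exact: mind.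
  move=> eps e0.
  have [|//|//|x N x0|x x0|N h] :=
    @sqint_dominated R n _ (fun k x => \sum_(j < k) \1_(F j) x) (fun=> 1) (mind _ mU) _ _ _ _ _ eps
      e0.
  + by move=> k; case: (agk k).
  + exact: sqint_cst_lty.
  + rewrite indicE normr1; case: (pselect ((\bigcup_k F k) x)) => [Ux|nUx].
      rewrite mem_set//; case: Ux => i _ Fi; rewrite (sumE _ i)//.
      by case: (i < N)%N; rewrite ?subrr ?normr0// subr0 normr1.
    rewrite memNset// big1 ?subrr ?normr0// => j _; rewrite indicE memNset// => Fj.
    by apply: nUx; exists j.
  + rewrite indicE; case: (pselect ((\bigcup_k F k) x)) => [Ux|nUx].
      rewrite mem_set//; case: Ux => i _ Fi.
      apply: cvg_near_cst; exists i.+1 => // k /= ik.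
      by rewrite (sumE _ i)// ik.
    rewrite memNset//; apply: cvg_near_cst; apply: nearW => k.
    rewrite big1// => j _; rewrite indicE memNset// => Fj.
    by apply: nUx; exists j.
  by exists (fun x => \sum_(j < N) \1_(F j) x).
- have E := RGenOInfty.measurableE R; by rewrite /measurable/= in E mA *; rewrite -E.
Qed.

(** The canonical simple functions increase to f, so f itself is a majorant of the error. *)
Lemma poly_approx_nneg (f : R -> R) : measurable_fun I f -> (forall x, 0 <= f x) ->
  (sqint f < +oo)%E -> poly_approx f.
Proof.
move=> mf f0 foo.
have mI : measurable I by [].
have mEf : measurable_fun I (EFin \o f) by exact/measurable_EFinP.
pose g := nnsfun_approx mI mEf.
have ag k : poly_approx (g k).
  apply: (@eq_poly_approx _ _ (fun x => \sum_(y \in range (g k)) y * \1_(g k @^-1` [set y]) x)).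
    by move=> x _; rewrite -fimfunE.
  under eq_fun do rewrite fsbig_finite//.
  by apply: poly_approx_sum => y; apply: poly_approxZ; apply: poly_approx_indic.
apply: poly_approx_lim => // eps e0.
have ff0 x : I x -> (0 <= (EFin \o f) x)%E by move=> _; rewrite lee_fin.
have [|x N x0|x x0|N h] := @sqint_dominated R n _ (fun k => g k : R -> R) f mf _ mf foo _ _ eps e0.
- by move=> k; case: (ag k).
- have Ix : I x by rewrite /= in_itv/= x0.
  have := le_approx N ff0 Ix.
  rewrite lee_fin -(nnsfun_approxE mI mEf) -/(g N) => gf.
  rewrite (ger0_norm (f0 x)) ger0_norm ?subr_ge0// gerBl.
  exact: fun_ge0.
- have Ix : I x by rewrite /= in_itv/= x0.
  by have /fine_cvgP[_] := cvg_nnsfun_approx mI mEf ff0 Ix.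
by exists (g N).
Qed.

Lemma poly_approx_sqint (f : R -> R) : measurable_fun I f -> (sqint f < +oo)%E -> poly_approx f.
Proof.
move=> mf foo.
have part (h : R -> R) : measurable_fun I h -> (forall x, 0 <= h x) -> (forall x, h x <= `|f x|) ->
  poly_approx h.
  move=> mh h0 hf; apply: poly_approx_nneg => //; apply: le_lt_trans foo.
  by apply: le_sqint => // x _; rewrite ger0_norm.
apply: (@eq_poly_approx _ _ (fun x => Num.max (f x) 0 + (-1) * Num.max (- f x) 0)).
  by move=> x _; case: (lerP (f x) 0); case: (lerP (- f x) 0); lra.
apply: poly_approxD; last apply: poly_approxZ.
- apply: part.
  + by apply: measurable_maxr.
  + by move=> x; rewrite le_max lexx orbT.
  + by move=> x; rewrite ge_max ler_norm normr_ge0.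
- apply: part.
  + by apply: measurable_maxr => //; exact: measurableT_comp.
  + by move=> x; rewrite le_max lexx orbT.
  + by move=> x; rewrite ge_max -normrN ler_norm normr_ge0.
Qed.
End Indicators.

Lemma measurable_fun_divXn (R : realType) (f : R -> R) (n : nat) :
  measurable_fun (`]0%R, +oo[ : set R) f ->
  measurable_fun (`]0%R, +oo[ : set R) (fun x => f x / x ^+ n).
Proof.
move=> mf; apply: measurable_funM => //.
apply: open_continuous_measurable_fun; first exact: interval_open.
move=> x; rewrite inE => /itv0y_gt0 x0; apply: cvgV; first by rewrite expf_neq0// gt_eqF.
exact: exprn_continuous.
Qed.

Lemma complete_Mpol (R : realType) (l b : nat) : (l <= b)%N ->
  @complete_in_L2 R (weight (2 * b + 1) l) (fun j => Mpol (2 * b + 1)%:R l j).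
Proof.
move=> lb f mf foo eps e0.
have mg := measurable_fun_divXn (2 * l) mf.
pose g x := f x / x ^+ (2 * l).
(* As (x^(2l) h)^2 x^(mu-2l) = h^2 x^(mu+2l), approximating f by x^(2l) p amounts to approximating g
   by p for the exponent mu+2l. *)
have gw (h : R -> R) : sqint (2 * b + 1 + 2 * l) h =
    (\int[@lebesgue_measure R]_(x in `]0%R,
      +oo[) ((x ^+ (2 * l) * h x) ^+ 2 * weight (2 * b + 1) l x)%:E)%E.
  apply: eq_integral => x; rewrite inE => /itv0y_gt0 x0; rewrite /weight.
  have -> : (2 * b + 1 + 2 * l = (2 * l) + (2 * l) + (2 * b + 1 - 2 * l))%N by lia.
  by rewrite !exprD; congr _%:E; ring.
have gE x : 0 < x -> x ^+ (2 * l) * g x = f x.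
  by move=> x0; rewrite mulrC divfK// expf_neq0// gt_eqF.
have goo : (sqint (2 * b + 1 + 2 * l) g < +oo)%E.
  rewrite gw; apply: le_lt_trans foo; rewrite le_eqVlt; apply/orP; left; apply/eqP.
  by apply: eq_integral => x; rewrite inE => /itv0y_gt0 x0; rewrite gE.
have [_ /(_ _ e0)[p gp]] := poly_approx_sqint mg goo.
have [N [c cE]] := span_XN lb p.
exists N, (fun j => c j / kappa R b j).
apply: le_lt_trans gp; rewrite le_eqVlt; apply/orP; left; apply/eqP.
rewrite gw; apply: eq_integral => x; rewrite inE => /itv0y_gt0 x0.
congr (_ ^+ 2 * _)%:E; rewrite mulrBr gE//; congr (_ - _).
have -> : x ^+ (2 * l) * p.[x] = ('X^(2 * l) * p).[x] by rewrite hornerM hornerXn.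
rewrite cE horner_sum; apply: eq_bigr => j _.
by rewrite Mpol_Npol// -/(kappa R b j) hornerZ mulrA divfK// kappa_neq0.
Qed.

Theorem theorem2p4 (R : realType) (l mu : nat) (Hodd : odd mu) (Hmu : (2 * l + 1 <= mu)%N) :
  (forall j k : nat,
     (@lebesgue_measure R).-integrable `]0%R, +oo[
        (fun x : R => (Mpol mu%:R l j x * Mpol mu%:R l k x * weight mu l x)%:E) /\
     (\int[@lebesgue_measure R]_(x in `]0%R, +oo[)
        ((Mpol mu%:R l j x * Mpol mu%:R l k x * weight mu l x)%:E))%E
     = (if j == k then
          2 * Gamma (j%:R + mu%:R + 1) * Gamma (j%:R + l%:R + (mu%:R + 3) / 2)
            * Gamma (j%:R - l%:R + (mu%:R + 1) / 2)
          / (j`!%:R * (2 * j%:R + mu%:R + 1) * Gamma (j%:R + (mu%:R + 1) / 2) ^+ 2)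
        else 0)%:E)
  /\ @complete_in_L2 R (weight mu l) (fun j => Mpol mu%:R l j).
Proof.
have muE : (mu = 2 * mu./2 + 1)%N by rewrite -[LHS]odd_double_half Hodd; lia.
move: mu./2 muE => b muE; rewrite {}muE in Hodd Hmu *.
have lb : (l <= b)%N by lia.
split; last exact: complete_Mpol.
move=> j k; split; first exact: integrable_MpolM.
rewrite integral_MpolM//; case: eqVneq => [<-|jk]; first by rewrite MpolM_norm.
by rewrite gram_neq ?mulr0.
Qed.
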